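(* Let $M$ be a connected smooth manifold, $\alpha$ a Riemannian metric on $M$ and $\beta$ a differential 1-form on $M$, and let $(M,F)$ be a Finsler space with $F=\sqrt[4]{\alpha^4+\beta^4}+\beta$. If $F$ is projectively flat, then $(M,F)$ is with reversible geodesics.
   Context: Here $\alpha=\alpha(x,y)=\sqrt{a_{ij}(x)y^iy^j}$ is the norm on $TM$ of a Riemannian metric and $\beta=\beta(x,y)=b_i(x)y^i$ is a smooth 1-form regarded as a function on $TM$; $F=\sqrt[4]{\alpha^4+\beta^4}+\beta$ is a function on $TM$ assumed to be a Finsler metric (positive, positively 1-homogeneous in $y$, smooth off the zero section, strongly convex; not necessarily symmetric under $y\mapsto -y$). It is called the Randers change of the Quartic metric $\sqrt[4]{\alpha^4+\beta^4}$. A Finsler metric $F$ is called (locally) projectively flat if all its geodesics are straight lines (in suitable local coordinates $(x^i)$ around each point). In such coordinates, with induced coordinates $(x^i,y^i)$ on $TM$, this is equivalent to Hamel's relation $\frac{\partial^2F}{\partial x^m\partial y^k}y^m-\frac{\partial F}{\partial x^k}=0$ for all $k$. Geodesics are those of the Finsler metric in the usual sense, considered as oriented paths (up to orientation-preserving reparametrization). A Finsler space $(M,F)$ is said to be with reversible geodesics if for every one of its oriented geodesic paths, the same path traversed in the opposite sense is also a geodesic of $F$; that is, for any geodesic $\gamma:[0,1]\to M$ of $F$, the reverse curve $\tilde\gamma(t)=\gamma(1-t)$ is also a geodesic of $F$ (up to orientation-preserving reparametrization). *)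

(* Defs.v *)
From HB Require Import structures.
From mathcomp Require Import all_boot all_order all_algebra.
From mathcomp Require Import all_classical all_reals all_analysis.
Set Implicit Arguments.
Unset Strict Implicit.
Unset Printing Implicit Defensive.
Import Order.TTheory GRing.Theory Num.Theory.
Import numFieldNormedType.Exports.
Local Open Scope classical_set_scope.
Local Open Scope ring_scope.

(* Used on open [U] of finite-dimensional spaces, where existence and
   continuity of all iterated directional derivatives is the usual C^k. *)
Fixpoint Ck_on (R : realType) (V W : normedModType R) (k : nat)
    (U : set V) (f : V -> W) : Prop :=
  (forall x, U x -> {for x, continuous f}) /\
  match k with
  | 0 => True
  | k'.+1 => forall v : V,
      (forall x, U x -> derivable f x v) /\ Ck_on k' U ('D_v f)
  end.

Definition smooth_on (R : realType) (V W : normedModType R)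
    (U : set V) (f : V -> W) : Prop :=
  forall k, Ck_on k U f.

(* The values of [cmap] off [cdom], and of [cinv] off the image of [cdom],
   are irrelevant. *)
Record chart (R : realType) (n : nat) (M : topologicalType) := Chart {
  cdom : set M;
  cmap : M -> 'rV[R]_n;
  cinv : 'rV[R]_n -> M;
  cdom_open : open cdom;
  cimg_open : open (cmap @` cdom);
  cmapK : forall p, cdom p -> cinv (cmap p) = p;
  cmap_continuous : forall p, cdom p -> {for p, continuous cmap};
  cinv_continuous : forall x, (cmap @` cdom) x -> {for x, continuous cinv}
}.

Definition cimg (R : realType) (n : nat) (M : topologicalType)
  (c : chart R n M) : set 'rV[R]_n := cmap c @` cdom c.

Definition transition (R : realType) (n : nat) (M : topologicalType)
  (c c' : chart R n M) : 'rV[R]_n -> 'rV[R]_n := cmap c' \o cinv c.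

Definition compatible (R : realType) (n : nat) (M : topologicalType)
    (c c' : chart R n M) : Prop :=
  smooth_on (cmap c @` (cdom c `&` cdom c')) (transition c c') /\
  smooth_on (cmap c' @` (cdom c `&` cdom c')) (transition c' c).

(* The atlas is maximal, so "a coordinate system" means "a member of [atlas]". *)
Record smooth_manifold (R : realType) (n : nat) := SmoothManifold {
  carrier :> topologicalType;
  atlas : set (chart R n carrier);
  manifold_hausdorff : hausdorff_space carrier;
  manifold_second_countable : @second_countable carrier;
  atlas_cover : forall p, exists2 c, atlas c & cdom c p;
  atlas_compatible : forall c c', atlas c -> atlas c' -> compatible c c';
  atlas_maximal :
    forall c, (forall c', atlas c' -> compatible c c') -> atlas c
}.

(* Tensor fields and functions on TM are given by their components in all
   the charts; components in a chart [c] matter only on [cimg c].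
   [tangent_map c c' p] is the change of components, from [c] to [c'], of
   tangent vectors at [p]. *)
Definition tangent_map (R : realType) (n : nat) (M : smooth_manifold R n)
    (c c' : chart R n M) (p : M) (v : 'rV[R]_n) : 'rV[R]_n :=
  'D_v (transition c c') (cmap c p).

Definition bilin (R : realType) (n : nat) (A : 'M[R]_n) (v w : 'rV[R]_n) : R :=
  \sum_(i < n) \sum_(j < n) A i j * v 0 i * w 0 j.

Definition lin (R : realType) (n : nat) (b v : 'rV[R]_n) : R :=
  \sum_(i < n) b 0 i * v 0 i.

Definition positive_definite (R : realType) (n : nat) (A : 'M[R]_n) : Prop :=
  forall v : 'rV[R]_n, v != 0 -> 0 < bilin A v v.

Record riemannian_metric (R : realType) (n : nat) (M : smooth_manifold R n) :=
  RiemannianMetric {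
  metric :> chart R n M -> 'rV[R]_n -> 'M[R]_n;
  metric_smooth : forall c i j, atlas c ->
    smooth_on (cimg c) (fun x => metric c x i j : R);
  metric_sym : forall c x, atlas c -> cimg c x -> (metric c x)^T = metric c x;
  metric_posdef : forall c x, atlas c -> cimg c x ->
    positive_definite (metric c x);
  metric_tensor : forall c c' p v w, atlas c -> atlas c' ->
    cdom c p -> cdom c' p ->
    bilin (metric c' (cmap c' p)) (tangent_map c c' p v) (tangent_map c c' p w)
    = bilin (metric c (cmap c p)) v w
}.

Record one_form (R : realType) (n : nat) (M : smooth_manifold R n) :=
  OneForm {
  form :> chart R n M -> 'rV[R]_n -> 'rV[R]_n;
  form_smooth : forall c i, atlas c ->
    smooth_on (cimg c) (fun x => form c x 0 i : R);
  form_tensor : forall c c' p v, atlas c -> atlas c' ->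
    cdom c p -> cdom c' p ->
    lin (form c' (cmap c' p)) (tangent_map c c' p v)
    = lin (form c (cmap c p)) v
}.

(* A pair (x, y) in the induced coordinates on TM. *)
Notation TMcoord R n := ('rV[R]_n * 'rV[R]_n)%type.

Definition TMfun (R : realType) (n : nat) (M : smooth_manifold R n) :=
  chart R n M -> TMcoord R n -> R.

Definition well_defined_on_TM (R : realType) (n : nat)
    (M : smooth_manifold R n) (F : TMfun M) : Prop :=
  forall c c' p y, atlas c -> atlas c' -> cdom c p -> cdom c' p ->
    F c' (cmap c' p, tangent_map c c' p y) = F c (cmap c p, y).

(* Partial derivatives with respect to x^i and y^i. *)
Definition dx (R : realType) (n : nat) (i : 'I_n) (f : TMcoord R n -> R) :
    TMcoord R n -> R :=
  'D_((delta_mx 0 i, 0) : TMcoord R n) f.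

Definition dy (R : realType) (n : nat) (i : 'I_n) (f : TMcoord R n -> R) :
    TMcoord R n -> R :=
  'D_((0, delta_mx 0 i) : TMcoord R n) f.

Definition fundamental_tensor (R : realType) (n : nat) (f : TMcoord R n -> R)
    (z : TMcoord R n) : 'M[R]_n :=
  \matrix_(i, j) (2^-1 * dy i (dy j (fun w => f w ^+ 2)) z).

Record finsler (R : realType) (n : nat) (M : smooth_manifold R n)
    (F : TMfun M) : Prop := Finsler {
  finsler_TM : well_defined_on_TM F;
  finsler_pos : forall c x y, atlas c -> cimg c x -> y != 0 -> 0 < F c (x, y);
  finsler_homogeneous : forall c x y (k : R), atlas c -> cimg c x -> 0 < k ->
    F c (x, k *: y) = k * F c (x, y);
  finsler_smooth : forall c, atlas c ->
    smooth_on [set z : TMcoord R n | cimg c z.1 /\ z.2 != 0] (F c);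
  finsler_convex : forall c x y, atlas c -> cimg c x -> y != 0 ->
    positive_definite (fundamental_tensor (F c) (x, y))
}.

(* G^i = 1/4 g^{il} ([F^2]_{x^k y^l} y^k - [F^2]_{x^l}) *)
Definition spray (R : realType) (n : nat) (f : TMcoord R n -> R)
    (z : TMcoord R n) : 'rV[R]_n :=
  let E := fun w => f w ^+ 2 in
  \row_i (4^-1 * \sum_(l < n) invmx (fundamental_tensor f z) i l *
    ((\sum_(k < n) dx k (dy l E) z * z.2 0 k) - dx l E z)).

(* The geodesic equation x'' + 2 G(x, x') = 0 for a regular curve in
   coordinates, at the parameter [s]. *)
Definition solves_geodesic_eq (R : realType) (n : nat) (f : TMcoord R n -> R)
    (x : R -> 'rV[R]_n) (s : R) : Prop :=
  [/\ derivable x s 1, derivable (derive1 x) s 1, derive1 x s != 0 &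
      derive1 (derive1 x) s + 2 *: spray f (x s, derive1 x s) = 0].

(* Constant-speed geodesics on [a, b].  A curve on [a, b] is represented by an
   extension to an open neighbourhood of [a, b] (solutions of the geodesic
   equation always extend); its values elsewhere are irrelevant.  The equation
   does not depend on coordinates: one chart around each point suffices. *)
Definition geodesic (R : realType) (n : nat) (M : smooth_manifold R n)
    (F : TMfun M) (a b : R) (g : R -> M) : Prop :=
  forall t, a <= t <= b -> exists2 c, atlas c &
    \forall s \near t, cdom c (g s) /\
      solves_geodesic_eq (F c) (fun u => cmap c (g u)) s.

Definition in_straight_line (R : realType) (n : nat) (a b : R)
    (x : R -> 'rV[R]_n) : Prop :=
  exists x0 v : 'rV[R]_n, v != 0 /\
    forall t, a <= t <= b -> exists s : R, x t = x0 + s *: v.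

Definition projectively_flat (R : realType) (n : nat) (M : smooth_manifold R n)
    (F : TMfun M) : Prop :=
  forall p : M, exists c, [/\ atlas c, cdom c p &
    forall (a b : R) (g : R -> M), a < b -> geodesic F a b g ->
      (forall t, a <= t <= b -> cdom c (g t)) ->
      in_straight_line a b (fun t => cmap c (g t))].

(* Orientation-preserving reparametrizations of [0, 1]; as above, they are
   represented by extensions to a neighbourhood of [0, 1]. *)
Definition reparametrization (R : realType) (phi : R -> R) : Prop :=
  [/\ phi 0 = 0, phi 1 = 1 &
      forall t : R, 0 <= t <= 1 -> \forall s \near t,
        [/\ derivable phi s 1, {for s, continuous (derive1 phi)} &
            0 < derive1 phi s]].

Definition reversible_geodesics (R : realType) (n : nat)
    (M : smooth_manifold R n) (F : TMfun M) : Prop :=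
  forall g : R -> M, geodesic F 0 1 g ->
    exists2 phi : R -> R, reparametrization phi &
      geodesic F 0 1 (fun t => g (1 - phi t)).

Definition alpha (R : realType) (n : nat) (M : smooth_manifold R n)
    (a : riemannian_metric M) : TMfun M :=
  fun c z => Num.sqrt (bilin (a c z.1) z.2 z.2).

Definition beta (R : realType) (n : nat) (M : smooth_manifold R n)
    (b : one_form M) : TMfun M :=
  fun c z => lin (b c z.1) z.2.

Definition quartic_randers (R : realType) (n : nat) (M : smooth_manifold R n)
    (a : riemannian_metric M) (b : one_form M) : TMfun M :=
  fun c z => (alpha a c z ^+ 4 + beta b c z ^+ 4) `^ 4^-1 + beta b c z.

(* Main.v *)
Require Import Defs.
From HB Require Import structures.
From mathcomp Require Import all_boot all_order all_algebra.
From mathcomp Require Import all_classical all_reals all_analysis.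
From mathcomp Require Import ring lra.
Set Implicit Arguments.
Unset Strict Implicit.
Unset Printing Implicit Defensive.
Import Order.TTheory GRing.Theory Num.Theory.
Import numFieldNormedType.Exports.
Local Open Scope classical_set_scope.
Local Open Scope ring_scope.

(** A projectively flat Finsler metric has reversible geodesics, because in the
    flat coordinates the geodesics starting at a point in opposite directions
    run along the same straight line, and this property is visible in every
    chart through the spray [G] of the geodesic equation [x'' + 2 G(x, x') = 0].

    In an arbitrary chart, take the two geodesics issued from [x] with
    velocities [y] and [- y]; they exist by the Picard-Lindelof theorem
    ([picard], [geodesic_exists]).  Push them to the flat chart with the
    transition map [T].  Their images move on straight lines, so the
    accelerations [DT(- 2 G(x, y)) + D^2 T(y, y)] and
    [DT(- 2 G(x, - y)) + D^2 T(y, y)] are both multiples of [DT(y)]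
    ([flat_second_order]).  Subtracting removes the second differential of [T]
    and shows that [G(x, - y) - G(x, y) = k y] for a scalar [k]
    ([spray_odd_part]).

    So along a geodesic [g] the reversed curve satisfies the geodesic equation up
    to a tangential term, and it remains to find the parametrization which
    absorbs this term globally on [[0, 1]], although [k] is only given chart by
    chart.  The reversed geodesic must have constant [F]-speed, which suggests the
    scalar [H(s) = F(g(s), - g'(s))] and the parameter [phi] with
    [phi' = C / H(1 - phi)] ([reparametrization_by_speed]).  Since [F] is
    constant along its own geodesic flow ([spray_conserves]), [H' = 2 k H]
    ([backward_speed_ode]), and then [g (1 - phi t)] solves the geodesic equation
    ([reverse_geodesic]). *)

(** * Functions with continuous partial derivatives *)

Lemma is_derive_comp_curve (R : realType) (V W : normedModType R)
    (f : V -> W) (x : R -> V) (t : R) (w : V) :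
  differentiable f (x t) -> is_derive t 1 x w ->
  is_derive t 1 (fun s => f (x s)) ('D_w f (x t)).
Proof.
move=> df [dx xw].
have dxt : differentiable x t by exact/derivable1_diffP.
have dfx : differentiable (f \o x) t by exact: differentiable_comp.
split; first exact/derivable1_diffP.
rewrite deriveE// diff_comp//= (deriveE w df); congr ('d f (x t) _).
by rewrite -deriveE.
Qed.

Lemma is_derive_line (R : realType) (V W : normedModType R)
    (f : V -> W) (z v : V) (t : R) :
  derivable f (z + t *: v) v ->
  is_derive t 1 (fun s => f (z + s *: v)) ('D_v f (z + t *: v)).
Proof.
rewrite /derivable => df.
have E : (fun h : R => h^-1 *: (((fun s => f (z + s *: v)) \o shift t) (h *: 1)
            - f (z + t *: v)))
    = (fun h : R => h^-1 *: ((f \o shift (z + t *: v)) (h *: v)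
            - f (z + t *: v))).
  apply/funext => h /=; congr (_ *: (f _ - _)).
  by rewrite scalerDl addrCA [_%:A]mulr1.
by split; rewrite /derivable /derive E.
Qed.

Lemma is_derive_line0 (R : realType) (V W : normedModType R)
    (f : V -> W) (z v : V) : differentiable f z ->
  is_derive (0 : R) (1 : R) (fun s : R => f (z + s *: v)) ('D_v f z).
Proof.
move=> df; have := @is_derive_line R V W f z v 0.
by rewrite scale0r addr0; apply; exact: diff_derivable.
Qed.

Lemma deriveNdir (R : realType) (V W : normedModType R) (f : V -> W) (z v : V) :
  differentiable f z -> 'D_(- v) f z = - 'D_v f z.
Proof. by move=> df; rewrite !deriveE// linearN. Qed.

Lemma is_derive_pair (R : realType) (V W : normedModType R) (f : R -> V)
    (h : R -> W) (t : R) (df : V) (dh : W) :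
  is_derive t (1 : R) f df -> is_derive t (1 : R) h dh ->
  is_derive t (1 : R) (fun u => (f u, h u)) (df, dh).
Proof.
move=> [df1 <-] [dh1 <-].
have f1 : differentiable f t by exact/derivable1_diffP.
have h1 : differentiable h t by exact/derivable1_diffP.
have fh : differentiable (fun u => (f u, h u)) t := differentiable_pair f1 h1.
split; first exact/derivable1_diffP.
by rewrite (deriveE _ fh) (diff_pair f1 h1) (deriveE _ f1) (deriveE _ h1).
Qed.

Lemma is_derive_sumr (R : realType) n (h : 'I_n -> R -> R) (x : R)
    (dh : 'I_n -> R) :
  (forall i, is_derive x (1 : R) (h i) (dh i)) ->
  is_derive x (1 : R) (fun t => \sum_i h i t) (\sum_i dh i).
Proof.
move=> hd; have := is_derive_sum hd; congr is_derive.
by apply/funext => t; rewrite fct_sumE.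
Qed.

(** Controlling [f] on the whole ball around [a] instead of the segment from [a]
    to [b] spares the callers a case distinction on the order of [a] and [b]. *)
Lemma MVT_bound (R : realType) (f df : R -> R) (a b K : R) :
  (forall t, `|t - a| <= `|b - a| -> is_derive t 1 f (df t) /\ `|df t| <= K) ->
  `|f b - f a| <= K * `|b - a|.
Proof.
wlog ab : a b f df / a < b.
  move=> H; case: (ltgtP a b) => [ab|ba|->]; [exact: H ab| |].
  - move=> fab.
    have fD t : `|t - - a| <= `|- b - - a| ->
      is_derive t 1 (fun s => f (- s)) (df (- t) * -1) /\ `|df (- t) * -1| <= K.
      rewrite !opprK => ht.
      have [|h1 h2] := fab (- t).
      + rewrite -normrN opprD !opprK (le_trans ht)//.
        by rewrite -normrN opprD opprK.
      + rewrite mulrN1 normrN; split => //.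
        have := @is_derive1_comp R f (fun s => - s) t _ _ h1 (is_deriveNid t 1).
        by rewrite mulrN1.
    have := H (- a) (- b) _ _ _ fD.
    by rewrite ltrN2 => /(_ ba); rewrite !opprK -(normrN (- b + a)) opprD !opprK.
  - by rewrite !subrr normr0 mulr0.
move=> fab.
have inab t : t \in `[a, b] -> `|t - a| <= `|b - a|.
  rewrite in_itv/= => /andP[at_ tb].
  by rewrite !ger0_norm ?subr_ge0 ?lerD2r// ltW.
have [||c cab ->] := @MVT R f df a b ab.
- by move=> x xab; apply: (fab x (inab _ _)).1; apply: subset_itv_oo_cc.
- apply: derivable_within_continuous => x xab.
  by have [[]] := fab x (inab _ xab).
- rewrite normrM ler_wpM2r//; apply: (fab c (inab _ _)).2.
  exact: subset_itv_oo_cc.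
Qed.

Lemma near_line (R : realType) (V : normedModType R) (U : set V) (z w : V) :
  open U -> U z -> \forall t \near (0 : R), U (z + t *: w).
Proof.
move=> oU Uz.
have c : {for (0 : R), continuous (fun t : R => z + t *: w)}.
  apply: cvgD; first exact: cvg_cst.
  by apply: cvgZr_tmp; exact: cvg_id.
by apply: c; rewrite scale0r addr0; exact: open_nbhs_nbhs.
Qed.

(** A basis together with its dual basis, normalised so that moving along one
    coordinate at a time never leaves a ball larger than the displacement
    dictates.  Points of a chart and points of its tangent bundle are treated
    alike through this interface. *)
Record frame (R : realType) (V : normedModType R) := Frame {
  fidx : finType;
  fvec : fidx -> V;
  fcoord : fidx -> V -> R;
  fvec_norm : forall i, `|fvec i| <= 1;
  fcoord_norm : forall i v, `|fcoord i v| <= `|v|;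
  fcoord_linear : forall i (a : R) u v,
    fcoord i (a *: u + v) = a * fcoord i u + fcoord i v;
  fcoord_vec : forall i j, fcoord i (fvec j) = (i == j)%:R;
  fcoord_sum : forall v, v = \sum_i fcoord i v *: fvec i
}.
Arguments fvec {R V} f i.
Arguments fcoord {R V} f i v.
Arguments fvec_norm {R V} f i.
Arguments fcoord_norm {R V} f i v.
Arguments fcoord_linear {R V} f i a u v.
Arguments fcoord_vec {R V} f i j.
Arguments fcoord_sum {R V} f v.

Section FrameCalculus.
Variables (R : realType) (V : normedModType R) (B : frame V).
Implicit Types (f : V -> R) (z w h : V).

Lemma sum_fcoord_le h : \sum_i `|fcoord B i h| <= #|fidx B|%:R * `|h|.
Proof.
rewrite mulr_natl -sumr_const; apply: ler_sum => i _; exact: fcoord_norm.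
Qed.

(** Move from [z] one coordinate at a time, applying the mean value theorem to
    each leg; the sum of the coordinates bounds the distance travelled, so all
    legs stay where the partial derivatives are under control. *)
Lemma increment_seq f (z0 : V) (rho eps : R) :
  (forall i w, `|w - z0| < rho ->
     derivable f w (fvec B i) /\ `|'D_(fvec B i) f w| <= eps) ->
  forall (s : seq (fidx B)) (k : fidx B -> R) z,
  `|z - z0| + \sum_(i <- s) `|k i| < rho ->
  `|f (z + \sum_(i <- s) k i *: fvec B i) - f z| <= eps * \sum_(i <- s) `|k i|.
Proof.
move=> fb; elim => [|i s IH] k z.
  by rewrite !big_nil !addr0 subrr normr0 mulr0.
rewrite !big_cons => hz.
have sum0 : 0 <= \sum_(j <- s) `|k j| by apply: sumr_ge0.
have ke : `|k i *: fvec B i| <= `|k i|.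
  by rewrite normrZ ler_piMr// fvec_norm.
have hz' : `|z + k i *: fvec B i - z0| + \sum_(j <- s) `|k j| < rho.
  apply: le_lt_trans hz; rewrite addrA lerD2r addrAC.
  by rewrite (le_trans (ler_normD _ _))// lerD2l.
have := IH k _ hz'; rewrite -addrA => h1.
have h2 : `|f (z + k i *: fvec B i) - f z| <= eps * `|k i|.
  have := @MVT_bound R (fun t => f (z + t *: fvec B i))
    (fun t => 'D_(fvec B i) f (z + t *: fvec B i)) 0 (k i) eps.
  rewrite subr0 scale0r addr0; apply => t; rewrite subr0 => tk.
  have [|d1 d2] := fb i (z + t *: fvec B i).
    apply: le_lt_trans hz; rewrite addrAC (le_trans (ler_normD _ _))//.
    rewrite lerD2l normrZ (@le_trans _ _ `|t|)// ?ler_piMr ?fvec_norm//.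
    by rewrite (le_trans tk)// lerDl.
  by split; [exact: is_derive_line|exact: d2].
rewrite -(subrKA (f (z + k i *: fvec B i))) (le_trans (ler_normD _ _))//.
by rewrite addrC mulrDr lerD.
Qed.

Lemma increment_le f (z0 : V) (rho eps : R) z h :
  (forall i w, `|w - z0| < rho ->
     derivable f w (fvec B i) /\ `|'D_(fvec B i) f w| <= eps) ->
  0 <= eps ->
  `|z - z0| + #|fidx B|%:R * `|h| < rho ->
  `|f (z + h) - f z| <= eps * (#|fidx B|%:R * `|h|).
Proof.
move=> fb e0 hz; rewrite {1}(fcoord_sum B h).
apply: le_trans (increment_seq fb _) _.
  by apply: le_lt_trans hz; rewrite lerD2l sum_fcoord_le.
by rewrite ler_wpM2l// sum_fcoord_le.
Qed.

Variables (U : set V) (f : V -> R).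
Hypotheses (oU : open U) (fC1 : Ck_on 1 U f).

Lemma near_fvec (z : V) (P : fidx B -> V -> Prop) :
  (forall i, \forall w \near z, P i w) ->
  exists2 rho : R, 0 < rho & forall i w, `|w - z| < rho -> P i w.
Proof.
move=> hP; have : \forall w \near z, forall i, P i w by apply: filter_forall.
move=> /nbhs_ballP[r /= r0 hr]; exists r => // i w wz.
by apply: hr; rewrite -ball_normE /= distrC.
Qed.

(** Continuous partial derivatives are bounded near [z], so the increments are
    controlled by the displacement. *)
Lemma C1_locally_lipschitz z : U z -> exists rho L : R, [/\ 0 < rho, 0 <= L &
  forall w w', `|w - z| < rho -> `|w' - z| < rho ->
    `|f w - f w'| <= L * `|w - w'|].
Proof.
move=> Uz; have [_ dU] := fC1.
pose N : R := #|fidx B|%:R.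
have [|r r0 hr] := @near_fvec z (fun i w => derivable f w (fvec B i) /\
    `|'D_(fvec B i) f w| <= `|'D_(fvec B i) f z| + 1).
  move=> i; have [di [ci _]] := dU (fvec B i); near=> w; split.
    by apply: di; near: w; exact: open_nbhs_nbhs.
  rewrite -lerBlDl (le_trans (lerB_dist _ _))//.
  rewrite distrC; apply/ltW; near: w.
  have /cvgrPdist_lt := ci z Uz; exact.
pose L := \sum_i (`|'D_(fvec B i) f z| + 1).
have L0 : 0 <= L by apply: sumr_ge0 => i _; rewrite addr_ge0.
have hL i : `|'D_(fvec B i) f z| + 1 <= L.
  by rewrite /L (bigD1 i)//= lerDl sumr_ge0// => j _; rewrite addr_ge0.
have N0 : 0 <= N by [].
have d0 : 0 < 1 + N * 2 by rewrite ltr_pwDl// mulr_ge0.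
exists (r / (1 + N * 2)), (L * N); split; first by rewrite divr_gt0.
  by rewrite mulr_ge0.
move=> w w' wz w'z.
have := @increment_le f z r L w' (w - w').
rewrite subrKC mulrA; apply => //.
  by move=> i u ur; have [? h] := hr i u ur; split => //; exact: le_trans (hL i).
have ww' : `|w - w'| <= (r / (1 + N * 2)) * 2.
  rewrite -(subrKA z) (le_trans (ler_normD _ _))// mulr_natr mulr2n.
  by rewrite lerD// ?(distrC z)// ltW.
rewrite (@lt_le_trans _ _ (r / (1 + N * 2) + N * ((r / (1 + N * 2)) * 2)))//.
  by rewrite ltr_leD// ler_wpM2l.
by rewrite mulrCA -[X in X + _]mulr1 -mulrDr divfK// gt_eqF.
Unshelve. all: by end_near. Qed.

(** Subtract the candidate differential [L]: the remainder has partial derivatives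
    that vanish at [z], hence are at most any given constant nearby, and its
    increments are then negligible by [increment_le]. *)
Lemma C1_differentiable z : U z -> differentiable f z.
Proof.
move=> Uz; have [_ dU] := fC1.
pose L h := \sum_i fcoord B i h * 'D_(fvec B i) f z.
have linL : linear L.
  move=> a u v; rewrite /L scaler_sumr -big_split /=; apply: eq_bigr => i _.
  by rewrite fcoord_linear mulrDl -mulrA.
pose lL := GRing.isLinear.Build _ _ _ _ L linL.
pose LL : {linear V -> R} := HB.pack L lL.
have Nle h : `|LL h| <= (\sum_i `|'D_(fvec B i) f z|) * `|h|.
  rewrite (le_trans (ler_norm_sum _ _ _))// mulr_suml ler_sum// => i _.
  by rewrite normrM mulrC ler_wpM2l// fcoord_norm.
have cL : continuous LL.
  apply: bounded_linear_continuous; apply/linear_boundedP; near=> M => x.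
  rewrite (le_trans (Nle x))// ler_wpM2r//.
have LE i : L (fvec B i) = 'D_(fvec B i) f z.
  rewrite /L (bigD1 i)//= big1 ?addr0 => [|j ji]; rewrite fcoord_vec.
    by rewrite eqxx mul1r.
  by rewrite (negPf ji) mul0r.
suff fL : f \o shift z = cst (f z) + LL +o_ 0 id.
  by apply/diff_locallyP; rewrite (diff_unique cL fL).
apply/eqaddoP => e e0.
pose N : R := #|fidx B|%:R.
have N10 : 0 < N + 1 by rewrite ltr_wpDl.
pose r w := f w - L w.
have rE w i : U w -> derivable r w (fvec B i) /\
    'D_(fvec B i) r w = 'D_(fvec B i) f w - 'D_(fvec B i) f z.
  move=> Uw; have [dfw _] := dU (fvec B i).
  have dL : is_derive w (fvec B i) L (L (fvec B i)).
    have := @linear_differentiable R V R LL w cL.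
    move=> dL; split; first exact: diff_derivable.
    by rewrite deriveE// (@diff_lin R V R LL w cL).
  have dfi : is_derive w (fvec B i) f ('D_(fvec B i) f w).
    by apply: derivableP; exact: dfw.
  have [r1 r2] := is_deriveB dfi dL.
  by split => //; rewrite -LE.
have [|d d0 hd] := @near_fvec z (fun i w => derivable r w (fvec B i) /\
    `|'D_(fvec B i) r w| <= e / (N + 1)).
  move=> i; have [di [ci _]] := dU (fvec B i); near=> w.
  have Uw : U w by near: w; exact: open_nbhs_nbhs.
  have [r1 r2] := rE w i Uw; split => //; rewrite r2 distrC.
  apply/ltW; near: w.
  have /cvgrPdist_lt := ci z Uz; apply; exact: divr_gt0.
near=> h => /=.
rewrite -[X in `|X| <= _]/(f (h + z) - (f z + L h)).
have -> : f (h + z) - (f z + L h) = r (z + h) - r z.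
  have LD : L (z + h) = L z + L h := linearD LL z h.
  by rewrite /r LD [h + z]addrC; ring.
have hz : `|z - z| + N * `|h| < d.
  rewrite subrr normr0 add0r (@le_lt_trans _ _ ((N + 1) * `|h|))//.
    by rewrite ler_wpM2r// lerDl.
  rewrite -ltr_pdivlMl// mulrC; near: h.
  by apply: cvgr0_norm_lt => //; exact: divr_gt0.
have eN0 : 0 <= e / (N + 1) by apply: divr_ge0; exact: ltW.
apply: le_trans (@increment_le r z d (e / (N + 1)) z h hd eN0 hz) _.
rewrite mulrA ler_wpM2r// -mulrAC ler_pdivrMr//.
by rewrite ler_wpM2l ?ltW// ltrDl.
Unshelve. all: by end_near. Qed.
End FrameCalculus.

(** * The algebra of C^k functions, and coordinates on the tangent bundle *)

Section CkAlgebra.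
Variables (R : realType) (V : normedModType R) (U : set V).
Hypothesis oU : open U.

Lemma CkS (W : normedModType R) k (f : V -> W) : Ck_on k.+1 U f -> Ck_on k U f.
Proof.
elim: k f => [|k IH] f [cf df]; split=> // v.
by have [d c] := df v; split => //; exact: IH.
Qed.

(** Derivatives at a point of an open set only see the values on that set; this
    lets the differentiability class be computed on convenient closed formulas. *)
Lemma Ck_ext (W : normedModType R) k (f g : V -> W) :
  (forall x, U x -> f x = g x) -> Ck_on k U f -> Ck_on k U g.
Proof.
have nearU (f' g' : V -> W) : (forall x, U x -> f' x = g' x) ->
    forall x, U x -> \forall y \near x, f' y = g' y.
  move=> fg x Ux; have : \forall y \near x, U y by exact: open_nbhs_nbhs.
  by apply: filterS.
elim: k f g => [|k IH] f g fg [cf df]; split => //.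
- move=> x Ux; rewrite /prop_for /continuous_at -fg//.
  by apply: cvg_trans (cf x Ux); apply: near_eq_cvg; exact: nearU.
- move=> x Ux; rewrite /prop_for /continuous_at -fg//.
  by apply: cvg_trans (cf x Ux); apply: near_eq_cvg; exact: nearU.
- move=> v; have [d c] := df v; split.
    by move=> x Ux; apply: near_eq_derivable (d x Ux); exact: nearU.
  by apply: IH c => x Ux; apply: near_eq_derive; exact: nearU.
Qed.

Lemma Ck_cst (W : normedModType R) k (c : W) : Ck_on k U (fun=> c).
Proof.
elim: k c => [|k IH] c; split => //; try by move=> x _; exact: cst_continuous.
move=> v; split; first by move=> x _; exact: derivable_cst.
by rewrite (_ : 'D_v _ = fun=> 0)//; apply/funext => x; exact: derive_cst.
Qed.

Lemma Ck_linear k (f : {linear V -> R}) : continuous f -> Ck_on k U f.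
Proof.
move=> cf; case: k => [|k]; split => //; try by move=> x _; exact: cf.
move=> v; split.
  by move=> x _; apply: diff_derivable; exact: linear_differentiable.
rewrite (_ : 'D_v f = fun=> f v); first exact: Ck_cst.
apply/funext => x; rewrite deriveE; last exact: linear_differentiable.
by rewrite diff_lin.
Qed.

Lemma Ck_add k (f g : V -> R) :
  Ck_on k U f -> Ck_on k U g -> Ck_on k U (fun x => f x + g x).
Proof.
elim: k f g => [|k IH] f g [cf df] [cg dg]; split => //;
  try by move=> x Ux; apply: cvgD; [exact: cf|exact: cg].
move=> v; have [dfv cfv] := df v; have [dgv cgv] := dg v; split.
  by move=> x Ux; apply: derivableD; [exact: dfv|exact: dgv].
apply: Ck_ext (IH _ _ cfv cgv) => x Ux; rewrite deriveD//.
  exact: dfv.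
exact: dgv.
Qed.

Lemma Ck_mul k (f g : V -> R) :
  Ck_on k U f -> Ck_on k U g -> Ck_on k U (fun x => f x * g x).
Proof.
elim: k f g => [|k IH] f g hf hg; split => //;
  try by move=> x Ux; apply: cvgM; [exact: hf.1|exact: hg.1].
move=> v; have [dfv cfv] := hf.2 v; have [dgv cgv] := hg.2 v; split.
  by move=> x Ux; apply: derivableM; [exact: dfv|exact: dgv].
have H := Ck_add (IH _ _ (CkS hf) cgv) (IH _ _ (CkS hg) cfv).
apply: Ck_ext H => x Ux; rewrite deriveM//.
  exact: dfv.
exact: dgv.
Qed.

Lemma Ck_opp k (f : V -> R) : Ck_on k U f -> Ck_on k U (fun x => - f x).
Proof.
move=> hf; have := Ck_mul (@Ck_cst _ k (-1 : R)) hf.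
by apply: Ck_ext => x _; rewrite mulN1r.
Qed.

Lemma Ck_inv k (f : V -> R) : (forall x, U x -> f x != 0) ->
  Ck_on k U f -> Ck_on k U (fun x => (f x)^-1).
Proof.
move=> f0; elim: k => [|k IH] hf; split => //;
  try by move=> x Ux; apply: cvgV; [exact: f0|exact: hf.1].
move=> v; have [dfv cfv] := hf.2 v; split.
  by move=> x Ux; apply: derivableV; [exact: f0|exact: dfv].
have If := IH (CkS hf).
have H := Ck_opp (Ck_mul (Ck_mul If If) cfv).
apply: Ck_ext H => x Ux; rewrite deriveV ?f0//; last exact: dfv.
by rewrite scaleNr expr2 invfM.
Qed.

Lemma Ck_sum (I : Type) (s : seq I) (P : pred I) k (f : I -> V -> R) :
  (forall i, Ck_on k U (f i)) -> Ck_on k U (fun x => \sum_(i <- s | P i) f i x).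
Proof.
move=> hf; elim: s => [|i s IH].
  by apply: Ck_ext (@Ck_cst _ k (0 : R)) => x _; rewrite big_nil.
case Pi : (P i).
  by apply: Ck_ext (Ck_add (hf i) IH) => x _; rewrite big_cons Pi.
by apply: Ck_ext IH => x _; rewrite big_cons Pi.
Qed.

Lemma Ck_prod (I : Type) (s : seq I) (P : pred I) k (f : I -> V -> R) :
  (forall i, Ck_on k U (f i)) -> Ck_on k U (fun x => \prod_(i <- s | P i) f i x).
Proof.
move=> hf; elim: s => [|i s IH].
  by apply: Ck_ext (@Ck_cst _ k (1 : R)) => x _; rewrite big_nil.
case Pi : (P i).
  by apply: Ck_ext (Ck_mul (hf i) IH) => x _; rewrite big_cons Pi.
by apply: Ck_ext IH => x _; rewrite big_cons Pi.
Qed.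

Lemma Ck_det n k (A : V -> 'M[R]_n) :
  (forall i j, Ck_on k U (fun x => A x i j)) -> Ck_on k U (fun x => \det (A x)).
Proof.
move=> hA; apply: Ck_sum => s; apply: Ck_mul; first exact: Ck_cst.
exact: Ck_prod.
Qed.

(** Cramer's rule writes the inverse as a quotient of polynomials in the
    entries. *)
Lemma Ck_invmx n k (A : V -> 'M[R]_n) i j :
  (forall x, U x -> A x \in unitmx) ->
  (forall i j, Ck_on k U (fun x => A x i j)) ->
  Ck_on k U (fun x => invmx (A x) i j).
Proof.
move=> uA hA.
have hdet := Ck_det hA.
have H : Ck_on k U (fun x => (\det (A x))^-1 * cofactor (A x) j i).
  apply: Ck_mul.
    by apply: Ck_inv hdet => x Ux; have := uA x Ux; rewrite unitmxE unitfE.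
  apply: Ck_mul; first exact: Ck_cst.
  apply: Ck_det => i' j'.
  by apply: Ck_ext (hA (lift j i') (lift i j')) => x _; rewrite !mxE.
by apply: Ck_ext H => x Ux; rewrite /invmx uA// !mxE.
Qed.

Lemma Ck_coord n k (f : V -> 'rV[R]_n) i :
  Ck_on k U f -> Ck_on k U (fun x => f x 0 i).
Proof.
elim: k f => [|k IH] f hf; split => //;
  try by move=> x Ux; apply: (@continuous_comp _ _ _ f (fun M : 'rV[R]_n => M 0 i));
    [exact: hf.1|exact: coord_continuous].
move=> v; have [dfv cfv] := hf.2 v; split.
  by move=> x Ux; have /derivable_mxP := dfv x Ux; exact.
by apply: Ck_ext (IH _ cfv) => x Ux; rewrite derive_mx ?mxE//; exact: dfv.
Qed.

End CkAlgebra.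

Section Frames.
Variables (R : realType) (n : nat).

Lemma coord_norm (v : 'rV[R]_n) i : `|v 0 i| <= `|v|.
Proof. by rewrite [leRHS]/Num.Def.normr/= mx_normrE; exact: (le_bigmax _ _ (0, i)). Qed.

Lemma delta_norm (i : 'I_n) : `|delta_mx 0 i : 'rV[R]_n| <= 1.
Proof.
rewrite [leLHS]/Num.Def.normr/= mx_normrE; apply: bigmax_le => // -[a b] _ /=.
by rewrite mxE normr_nat; case: (_ && _); rewrite ?lexx ?ler01.
Qed.

Lemma row_norm_le (v : 'rV[R]_n) (K : R) : 0 <= K ->
  (forall i, `|v 0 i| <= K) -> `|v| <= K.
Proof.
move=> K0 h; rewrite [leLHS]/Num.Def.normr/= mx_normrE; apply: bigmax_le => //.
by move=> [a b] _ /=; rewrite ord1.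
Qed.

Lemma row_neq0 (v : 'rV[R]_n) : v != 0 -> exists i, v 0 i != 0.
Proof.
move=> v0; apply/existsP; apply: contraNT v0 => /existsPn h.
by apply/eqP/rowP => i; rewrite mxE; apply/eqP; have := h i; rewrite negbK.
Qed.

Definition row_frame : frame 'rV[R]_n.
refine (@Frame R 'rV[R]_n 'I_n (fun i => delta_mx 0 i) (fun i v => v 0 i)
  delta_norm _ _ _ _).
- by move=> i v; exact: coord_norm.
- by move=> i a u v; rewrite !mxE.
- by move=> i j; rewrite !mxE eqxx.
- exact: row_sum_delta.
Defined.

Lemma pair_norm (x y : 'rV[R]_n) : `|(x, y)| = Num.max `|x| `|y|.
Proof. by []. Qed.

Definition TMfvec (i : 'I_n + 'I_n) : TMcoord R n :=
  match i with inl j => (delta_mx 0 j, 0) | inr j => (0, delta_mx 0 j) end.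

Definition TMfcoord (i : 'I_n + 'I_n) (v : TMcoord R n) : R :=
  match i with inl j => v.1 0 j | inr j => v.2 0 j end.

Lemma sum_pair (I : Type) (s : seq I) (f : I -> TMcoord R n) :
  \sum_(i <- s) f i = (\sum_(i <- s) (f i).1, \sum_(i <- s) (f i).2).
Proof.
by elim: s => [|i s IH]; rewrite ?big_nil// !big_cons IH; case: (f i).
Qed.

Definition TM_frame : frame (TMcoord R n).
refine (@Frame R (TMcoord R n) ('I_n + 'I_n)%type TMfvec TMfcoord _ _ _ _ _).
- by case=> i; rewrite pair_norm normr0 ge_max ler01 delta_norm.
- case=> i [x y]; rewrite pair_norm le_max/= coord_norm//.
  by rewrite orbT.
- by case=> i a [x y] [z t]; rewrite /= !mxE.
- by case=> i [] j; rewrite /= !mxE ?eqxx.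
- move=> [x y]; rewrite big_sumType/= !sum_pair/=.
  have z0 (f : 'I_n -> R) : \sum_i f i *: (0 : 'rV[R]_n) = 0.
    by rewrite big1// => i _; rewrite scaler0.
  rewrite !z0 -!row_sum_delta -[RHS]/(x + 0, 0 + y).
  by rewrite addr0 add0r.
Defined.

End Frames.

(** * Regularity, homogeneity and conservation law of the spray *)

Section Spray.
Variables (R : realType) (n : nat) (U : set 'rV[R]_n) (f : TMcoord R n -> R).
Hypothesis oU : open U.

(** The slit tangent bundle in coordinates, where Finsler functions are
    smooth. *)
Definition slit : set (TMcoord R n) := [set z | U z.1 /\ z.2 != 0].

Hypothesis fhom : forall x y (k : R), U x -> 0 < k -> f (x, k *: y) = k * f (x, y).
Hypothesis fsm : smooth_on slit f.
Hypothesis fpos : forall x y, U x -> y != 0 -> 0 < f (x, y).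
Hypothesis fcvx : forall x y, U x -> y != 0 ->
  positive_definite (fundamental_tensor f (x, y)).

Let E := fun w => f w ^+ 2.

Lemma open_slit : open slit.
Proof.
rewrite openE => -[x y] [/= Ux y0].
have [i yi] := row_neq0 y0.
rewrite /interior /=; near=> z; split.
  near: z; exists (U, setT) => /=; last by case=> ? ? [].
  by split; [exact: open_nbhs_nbhs|exact: filterT].
have : z.2 0 i != 0.
  near: z.
  have cz : {for (x, y), continuous (fun z : TMcoord R n => z.2 0 i)}.
    apply: (@continuous_comp _ _ _ snd (fun M : 'rV[R]_n => M 0 i)).
      exact: cvg_snd.
    exact: coord_continuous.
  have nb : nbhs (y 0 i) [set r : R | r != 0].
    by apply: open_nbhs_nbhs; split => //; exact: open_neq.
  exact: (cz _ nb).
by apply: contraNN => /eqP ->; rewrite mxE.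
Unshelve. all: by end_near. Qed.

Lemma Ck_E k : Ck_on k slit E.
Proof.
by apply: (Ck_ext open_slit _ (Ck_mul open_slit (fsm k) (fsm k))) => z _.
Qed.

Lemma Ck_dir k v (h : TMcoord R n -> R) :
  Ck_on k.+1 slit h -> Ck_on k slit ('D_v h).
Proof. by move=> [_ dh]; have [] := dh v. Qed.

Lemma slit_differentiable (h : TMcoord R n -> R) z :
  Ck_on 1 slit h -> slit z -> differentiable h z.
Proof. by move=> h1; apply: (C1_differentiable (TM_frame R n) open_slit h1). Qed.

Lemma dxyE (h : TMcoord R n -> R) z u v : differentiable h z ->
  'D_((u, v) : TMcoord R n) h z
    = (\sum_i u 0 i * dx i h z) + (\sum_i v 0 i * dy i h z).
Proof.
move=> dh; rewrite deriveE// {1}(fcoord_sum (TM_frame R n) (u, v)).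
rewrite linear_sum big_sumType/=; congr (_ + _); apply: eq_bigr => i _.
  by rewrite linearZ /dx deriveE.
by rewrite linearZ /dy deriveE.
Qed.

Lemma derive_fiberE (h : TMcoord R n -> R) z v : differentiable h z ->
  'D_((0, v) : TMcoord R n) h z = \sum_i v 0 i * dy i h z.
Proof.
move=> dh; rewrite dxyE// [X in X + _]big1 ?add0r// => i _.
by rewrite mxE mul0r.
Qed.

Lemma fundamental_tensorE z i j :
  fundamental_tensor f z i j = 2^-1 * dy i (dy j E) z.
Proof. by rewrite mxE. Qed.

Lemma sprayE z i : spray f z 0 i = 4^-1 * \sum_(l < n)
    invmx (fundamental_tensor f z) i l *
    ((\sum_(k < n) dx k (dy l E) z * z.2 0 k) - dx l E z).
Proof. by rewrite mxE. Qed.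

Lemma Ck_fundamental_tensor k i j :
  Ck_on k slit (fun z => fundamental_tensor f z i j).
Proof.
have H : Ck_on k slit (fun z => 2^-1 * dy i (dy j E) z).
  apply: (Ck_mul open_slit); first exact: Ck_cst.
  by apply: Ck_dir; apply: Ck_dir; exact: Ck_E.
by apply: (Ck_ext open_slit _ H) => z _; rewrite mxE.
Qed.

Lemma posdef_unitmx m (A : 'M[R]_m) : positive_definite A -> A \in unitmx.
Proof.
move=> pA; rewrite unitmxE unitfE; apply/negP => /det0P[v v0 vA].
suff : bilin A v v = 0 by move=> h; have := pA v v0; rewrite h ltxx.
rewrite /bilin exchange_big/= big1// => j _.
have /rowP/(_ j) := vA; rewrite !mxE => h.
by rewrite -big_distrl/= (eq_bigr _ (fun i _ => mulrC _ _)) h mul0r.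
Qed.

Lemma fundamental_tensor_unit z : slit z -> fundamental_tensor f z \in unitmx.
Proof. by case: z => x y [/= Ux y0]; apply: posdef_unitmx; exact: fcvx. Qed.

Lemma Ck_spray k i : Ck_on k slit (fun z => spray f z 0 i).
Proof.
have o := open_slit.
have H : Ck_on k slit (fun z => 4^-1 * \sum_(l < n)
    invmx (fundamental_tensor f z) i l *
    ((\sum_(k < n) dx k (dy l E) z * z.2 0 k) - dx l E z)).
  apply: (Ck_mul o); first exact: Ck_cst.
  apply: (Ck_sum o) => l; apply: (Ck_mul o).
    apply: (Ck_invmx o); first exact: fundamental_tensor_unit.
    exact: Ck_fundamental_tensor.
  apply: (Ck_add o).
    apply: (Ck_sum o) => j; apply: (Ck_mul o).
      by apply: Ck_dir; apply: Ck_dir; exact: Ck_E.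
    pose g (z : TMcoord R n) : R := z.2 0 j.
    have lg : linear g by move=> a u v; rewrite /g !mxE.
    pose lg' := GRing.isLinear.Build _ _ _ _ g lg.
    pose G : {linear TMcoord R n -> R} := HB.pack g lg'.
    have cG : continuous G.
      move=> z; apply: (@continuous_comp _ _ _ snd (fun M : 'rV[R]_n => M 0 j)).
        exact: cvg_snd.
      exact: coord_continuous.
    exact: (Ck_linear _ k cG).
  apply: (Ck_opp o); apply: Ck_dir; exact: Ck_E.
by apply: (Ck_ext o _ H) => z _; rewrite mxE.
Qed.

(** Fibrewise dilation is a linear map, so differentiating
    [h (x, k *: y) = c * h (x, y)] dilates the direction of differentiation. *)
Lemma derive_scale (h : TMcoord R n -> R) (k c : R) x y u v :
  0 < k -> (forall z, slit z -> differentiable h z) ->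
  (forall x y, slit (x, y) -> h (x, k *: y) = c * h (x, y)) ->
  slit (x, y) ->
  'D_((u, k *: v) : TMcoord R n) h (x, k *: y)
    = c * 'D_((u, v) : TMcoord R n) h (x, y).
Proof.
move=> k0 dh hh sxy.
have skxy : slit (x, k *: y).
  by case: sxy => /= Ux y0; split => //=; rewrite scaler_eq0 negb_or gt_eqF.
have d1 : is_derive (0 : R) 1
    (fun t => h ((x, k *: y) + t *: ((u, k *: v) : TMcoord R n)))
    ('D_((u, k *: v) : TMcoord R n) h (x, k *: y)).
  exact/is_derive_line0/dh.
have d2 : is_derive (0 : R) 1
    (fun t => c * h ((x, y) + t *: ((u, v) : TMcoord R n)))
    (c * 'D_((u, v) : TMcoord R n) h (x, y)).
  apply: is_deriveZ.
  exact/is_derive_line0/dh.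
rewrite -(@derive_val _ _ _ _ _ _ _ d1) -(@derive_val _ _ _ _ _ _ _ d2).
apply: near_eq_derive.
have := near_line (u, v) open_slit sxy; apply: filterS => t st.
rewrite -hh//=; congr (h (_, _)).
by rewrite -[LHS]/(k *: y + t *: (k *: v)) scalerDr !scalerA mulrC.
Qed.

Definition homog (k c : R) (h : TMcoord R n -> R) :=
  forall x y, slit (x, y) -> h (x, k *: y) = c * h (x, y).

Lemma homog_dx k c h i : 0 < k -> (forall m, Ck_on m slit h) ->
  homog k c h -> homog k c (dx i h).
Proof.
move=> k0 sh hh x y sxy; rewrite /dx.
have := @derive_scale h k c x y (delta_mx 0 i) 0 k0.
rewrite scaler0; apply => //.
by move=> z; exact: slit_differentiable.
Qed.

Lemma homog_dy k c h i : 0 < k -> (forall m, Ck_on m slit h) ->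
  homog k (k * c) h -> homog k c (dy i h).
Proof.
move=> k0 sh hh x y sxy; rewrite /dy.
have dh z : slit z -> differentiable h z by apply: slit_differentiable.
have := @derive_scale h k (k * c) x y 0 (delta_mx 0 i) k0 dh hh sxy.
have skxy : slit (x, k *: y).
  by case: sxy => /= Ux y0; split => //=; rewrite scaler_eq0 negb_or gt_eqF.
have -> : (0, k *: delta_mx 0 i) = k *: ((0, delta_mx 0 i) : TMcoord R n).
  by rewrite -[RHS]/(k *: 0, k *: delta_mx 0 i) scaler0.
rewrite deriveE; last exact: dh.
rewrite linearZ/= -mulrA => /(mulfI (lt0r_neq0 k0)).
by rewrite -deriveE//; exact: dh.
Qed.

Lemma homog_E k : 0 < k -> homog k (k * (k * 1)) E.
Proof.
move=> k0 x y [/= Ux _]; rewrite /E fhom//; ring.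
Qed.

Lemma smooth_dir v (h : TMcoord R n -> R) :
  (forall k, Ck_on k slit h) -> forall k, Ck_on k slit ('D_v h).
Proof. by move=> sh k; apply: Ck_dir. Qed.

(** Each fibre derivative of the energy [f ^+ 2] lowers its degree of homogeneity
    by one and derivatives along the base preserve it: the fundamental tensor
    has degree 0 and the spray degree 2. *)
Lemma spray_homog x y k : slit (x, y) -> 0 < k ->
  spray f (x, k *: y) = k ^+ 2 *: spray f (x, y).
Proof.
move=> sxy k0.
have gE : fundamental_tensor f (x, k *: y) = fundamental_tensor f (x, y).
  apply/matrixP => i j.
  apply: etrans (fundamental_tensorE _ _ _) _.
  apply: etrans _ (esym (fundamental_tensorE _ _ _)).
  have h1 := homog_dy j k0 Ck_E (homog_E k0).
  have h2 := homog_dy i k0 (smooth_dir _ Ck_E) h1.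
  by rewrite (h2 _ _ sxy) mul1r.
have eqS l : (\sum_(j < n) dx j (dy l E) (x, k *: y) * (x, k *: y).2 0 j)
    - dx l E (x, k *: y)
  = k ^+ 2 * ((\sum_(j < n) dx j (dy l E) (x, y) * (x, y).2 0 j)
    - dx l E (x, y)).
  have h1 := homog_dy l k0 Ck_E (homog_E k0).
  rewrite (homog_dx l k0 Ck_E (homog_E k0) sxy) mulr1 -expr2 mulrBr mulr_sumr.
  congr (_ - _); apply: eq_bigr => j _.
  rewrite (homog_dx j k0 (smooth_dir _ Ck_E) h1 sxy) mulr1 expr2.
  have -> : (x, k *: y).2 0 j = k * y 0 j by rewrite mxE.
  by rewrite -!mulrA; congr (_ * _); rewrite mulrCA.
apply/rowP => i; rewrite sprayE [RHS]mxE sprayE gE mulrCA.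
apply: (congr1 ( *%R 4^-1)); rewrite mulr_sumr.
by apply: eq_bigr => l _; rewrite eqS mulrCA.
Qed.

(** Differentiate along the ray through [y]. *)
Lemma euler (h : TMcoord R n -> R) x y : slit (x, y) ->
  differentiable h (x, y) -> (forall k, 0 < k -> homog k k h) ->
  'D_((0, y) : TMcoord R n) h (x, y) = h (x, y).
Proof.
move=> sxy dh hh.
have d1 : is_derive (0 : R) 1
    (fun t => h ((x, y) + t *: ((0, y) : TMcoord R n)))
    ('D_((0, y) : TMcoord R n) h (x, y)).
  exact: is_derive_line0.
have d2 : is_derive (0 : R) 1 (fun t : R => (1 + t) * h (x, y)) (h (x, y)).
  have := is_deriveD (is_derive_cst (h (x, y)) (0 : R) (1 : R))
    (is_deriveZ (h (x, y)) (is_derive_id (0 : R) (1 : R))).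
  rewrite add0r [_ *: 1]mulr1; congr is_derive; apply/funext => t.
  by rewrite mulrDl mul1r mulrC.
rewrite -(@derive_val _ _ _ _ _ _ _ d1) -[RHS](@derive_val _ _ _ _ _ _ _ d2).
apply: near_eq_derive.
near=> t.
have t0 : 0 < 1 + t.
  suff : `|t| < 1 by rewrite ltr_norml => /andP[]; rewrite -subr_gt0 opprK addrC.
  by near: t; apply: cvgr0_norm_lt => //.
rewrite -(hh _ t0)//; congr (h (_, _)); rewrite /= ?scaler0 ?addr0//.
by rewrite scalerDl scale1r.
Unshelve. all: by end_near. Qed.

Lemma euler_f x y : slit (x, y) -> 'D_((0, y) : TMcoord R n) f (x, y) = f (x, y).
Proof.
move=> sxy; apply: euler => //; first exact: slit_differentiable.
by move=> k k0 u v [/= Uu _]; exact: fhom.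
Qed.

Lemma derive_E z v : slit z -> 'D_v E z = 2 * f z * 'D_v f z.
Proof.
move=> sz.
have dfz : derivable f z v by apply/diff_derivable/slit_differentiable.
have -> : E = f * f by apply/funext => w; rewrite /E expr2.
by rewrite deriveM// -[LHS]/(_ * _ + _ * _); ring.
Qed.

(** [f] is constant along its geodesics: contracting the defining equation of the
    spray with the velocity turns, by Euler's identities, the fundamental
    tensor into the fibre derivative of the energy and the mixed second
    derivatives into twice its base derivative, and what remains is the
    vanishing of the derivative of the energy along the geodesic flow. *)
Lemma spray_conserves x y : slit (x, y) ->
  'D_((y, - (2 *: spray f (x, y))) : TMcoord R n) f (x, y) = 0.
Proof.
move=> sxy; set G := spray f (x, y).
have dE z : slit z -> differentiable E z.
  by apply: slit_differentiable; exact: Ck_E.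
have dDE v z : slit z -> differentiable ('D_v E) z.
  by apply: slit_differentiable; exact: smooth_dir _ Ck_E _.
suff : 'D_((y, - (2 *: G)) : TMcoord R n) E (x, y) = 0.
  rewrite derive_E// => /eqP; rewrite mulf_eq0 => /orP[|/eqP//].
  by case: sxy => /= Ux y0; rewrite mulf_eq0 pnatr_eq0/= gt_eqF// fpos.
(* the definition of the spray, with the inverse metric cleared *)
have gG l : \sum_i fundamental_tensor f (x, y) l i * (4 * G 0 i)
    = (\sum_k dx k (dy l E) (x, y) * y 0 k) - dx l E (x, y).
  pose S := \col_l ((\sum_k dx k (dy l E) (x, y) * y 0 k) - dx l E (x, y)).
  have GE i : 4 * G 0 i = (invmx (fundamental_tensor f (x, y)) *m S) i 0.
    rewrite !mxE mulrA divff ?pnatr_eq0// mul1r; apply: eq_bigr => j _.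
    by rewrite mxE.
  transitivity ((fundamental_tensor f (x, y) *m
     (invmx (fundamental_tensor f (x, y)) *m S)) l 0).
    by rewrite [RHS]mxE; apply: eq_bigr => i _; rewrite GE.
  by rewrite mulKVmx ?fundamental_tensor_unit// mxE.
have euler2 i : \sum_l y 0 l * dy l (dy i E) (x, y) = dy i E (x, y).
  have <- : 'D_((0, y) : TMcoord R n) (dy i E) (x, y) = dy i E (x, y).
    apply: euler => //; first exact: dDE.
    move=> k k0; apply: homog_dy Ck_E _ => //.
    by have := homog_E k0; rewrite mulr1.
  by rewrite derive_fiberE//; exact: dDE.
have eulerE z : slit z -> 'D_((0, z.2) : TMcoord R n) E z = 2 * E z.
  by case: z => u v suv; rewrite derive_E// euler_f// /E; ring.
(* along a horizontal direction the contraction vector stays equal to the fibre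
   coordinate, so Euler's identity may be differentiated *)
have mixed k : \sum_l y 0 l * dx k (dy l E) (x, y) = 2 * dx k E (x, y).
  pose w : TMcoord R n := (delta_mx 0 k, 0).
  have d1 : is_derive (0 : R) 1 (fun t => \sum_l y 0 l * dy l E ((x, y) + t *: w))
     (\sum_l y 0 l * dx k (dy l E) (x, y)).
    apply: is_derive_sumr => l; apply: is_deriveZ.
    exact/is_derive_line0/dDE.
  have d2 : is_derive (0 : R) 1 (fun t => 2 * E ((x, y) + t *: w)) (2 * dx k E (x, y)).
    apply: is_deriveZ.
    exact/is_derive_line0/dE.
  rewrite -(@derive_val _ _ _ _ _ _ _ d1) -[RHS](@derive_val _ _ _ _ _ _ _ d2).
  apply: near_eq_derive; have := near_line w open_slit sxy; apply: filterS => t st.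
  rewrite -eulerE// derive_fiberE; last exact: dE.
  by apply: eq_bigr => l _; rewrite /= scaler0 addr0.
have key : 2 * (\sum_i G 0 i * dy i E (x, y)) = \sum_k y 0 k * dx k E (x, y).
  transitivity (\sum_l y 0 l * \sum_i fundamental_tensor f (x, y) l i * (4 * G 0 i)).
    under [RHS]eq_bigr do rewrite mulr_sumr.
    rewrite exchange_big/= mulr_sumr; apply: eq_bigr => i _.
    rewrite -euler2 !mulr_sumr; apply: eq_bigr => l _.
    rewrite (fundamental_tensorE (x, y) l i).
    set a := dy l _ _; set b := G 0 i; set c := y 0 l.
    by field.
  under eq_bigr do rewrite gG mulrBr mulr_sumr.
  rewrite sumrB exchange_big/=.
  have -> : \sum_(j < n) \sum_(i < n) y 0 i * (dx j (dy i E) (x, y) * y 0 j)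
     = \sum_k 2 * (y 0 k * dx k E (x, y)).
    apply: eq_bigr => k _; rewrite mulrCA -mixed mulr_sumr; apply: eq_bigr => l _.
    ring.
  by rewrite -mulr_sumr; ring.
rewrite dxyE; last exact: dE.
rewrite -key mulr_sumr -big_split/= big1// => i _; rewrite !mxE; ring.
Qed.

End Spray.

(** * The Picard-Lindelof theorem *)

Section Picard.
Variable R : realType.

Lemma primitive_exists (u : R -> R) (T : R) : 0 < T -> continuous u ->
  exists U : R -> R, U 0 = 0 /\ forall t : R, `|t| < T -> is_derive t (1 : R) U (u t).
Proof.
move=> T0 cu.
pose F (x : R) := (\int[lebesgue_measure]_(t in `[- T, x]) u t)%R.
exists (fun x => F x - F 0); split; first by rewrite subrr.
move=> t; rewrite ltr_norml => /andP[t1 t2].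
have [||d dE] := @continuous_FTC1_closed R u (- T) t T t2 _ t1 _.
- apply: continuous_compact_integrable; first exact: segment_compact.
  exact: continuous_subspaceT.
- exact: cu.
have h1 : is_derive t (1 : R) F (u t) by split; [exact: d|rewrite -derive1E; exact: dE].
have := is_deriveB h1 (is_derive_cst (F 0) (t : R) (1 : R)).
by rewrite subr0.
Qed.

Lemma is_derive_row n (x : R -> 'rV[R]_n) (t : R) (w : 'rV[R]_n) :
  (forall i, is_derive t (1 : R) (fun s => x s 0 i) (w 0 i)) -> is_derive t (1 : R) x w.
Proof.
move=> h; have d : derivable x t 1.
  by apply/derivable_mxP => i j; rewrite (ord1 i); have [] := h j.
split => //; rewrite derive_mx//; apply/rowP => i; rewrite mxE.
by have [] := h i.
Qed.

Lemma is_derive_coord n (x : R -> 'rV[R]_n) (t : R) (w : 'rV[R]_n) i :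
  is_derive t (1 : R) x w -> is_derive t (1 : R) (fun s => x s 0 i) (w 0 i).
Proof.
move=> [d <-]; split; first by move/derivable_mxP : d; exact.
by rewrite derive_mx// mxE.
Qed.

Lemma row_primitive_exists n (u : R -> 'rV[R]_n) (T : R) : 0 < T ->
  continuous u ->
  exists U : R -> 'rV[R]_n, U 0 = 0 /\ forall t : R, `|t| < T -> is_derive t (1 : R) U (u t).
Proof.
move=> T0 cu.
have /choice[U hU] : forall i, exists U : R -> R, U 0 = 0 /\
    forall t : R, `|t| < T -> is_derive t (1 : R) U (u t 0 i).
  move=> i; apply: primitive_exists => // t.
  apply: (@continuous_comp _ _ _ u (fun M : 'rV[R]_n => M 0 i)); first exact: cu.
  exact: coord_continuous.
exists (fun t => \row_i U i t); split.
  by apply/rowP => i; rewrite !mxE; exact: (hU i).1.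
move=> t tT; apply: is_derive_row => i.
have := (hU i).2 t tT; congr is_derive; apply/funext => s; by rewrite mxE.
Qed.

(** The factor [`|t|] is what makes Picard's operator contract on short
    intervals. *)
Lemma primitive_bound n (U u : R -> 'rV[R]_n) (T K t : R) : 0 <= K ->
  (forall s : R, `|s| < T -> is_derive s (1 : R) U (u s)) ->
  (forall s, `|u s| <= K) -> `|t| < T -> `|U t - U 0| <= K * `|t|.
Proof.
move=> K0 dU uK tT; apply: row_norm_le => [|i]; first by rewrite mulr_ge0.
rewrite !mxE.
have := @MVT_bound R (fun s => U s 0 i) (fun s => u s 0 i) 0 t K.
rewrite subr0; apply => s; rewrite subr0 => st; split.
  by apply: is_derive_coord; apply: dU; exact: le_lt_trans tT.
exact: le_trans (coord_norm _ _) (uK s).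
Qed.

(** [a k - 2 * C * 2^-k] increases, [a k + 2 * C * 2^-k] decreases, and the
    supremum of the former lies between them. *)
Lemma geometric_limit (a : nat -> R) (C : R) : 0 <= C ->
  (forall k, `|a k.+1 - a k| <= C * 2^-1 ^+ k) ->
  exists l, forall k, `|a k - l| <= 2 * C * 2^-1 ^+ k.
Proof.
move=> C0 ha.
pose b k := a k - 2 * C * 2^-1 ^+ k.
pose c k := a k + 2 * C * 2^-1 ^+ k.
have bS k : b k <= b k.+1.
  have := ha k; rewrite ler_norml /b exprS => /andP[h1 h2].
  set q := 2^-1 ^+ k in h1 h2 *; lra.
have cS k : c k.+1 <= c k.
  have := ha k; rewrite ler_norml /c exprS => /andP[h1 h2].
  set q := 2^-1 ^+ k in h1 h2 *; lra.
have bm : {homo b : m k / (m <= k)%N >-> m <= k} by exact/nondecreasing_seqP.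
have cm : {homo c : m k / (m <= k)%N >-> k <= m} by exact/nonincreasing_seqP.
have bc k j : b k <= c j.
  apply: (@le_trans _ _ (b (maxn k j))); first exact/bm/leq_maxl.
  apply: (@le_trans _ _ (c (maxn k j))); last exact/cm/leq_maxr.
  have : 0 <= C * 2^-1 ^+ maxn k j by rewrite mulr_ge0.
  by rewrite /b /c -!mulrA; set q := C * _; lra.
have ub j : ubound (range b) (c j) by move=> _ [k _ <-].
have hs : has_sup (range b) by split; [exists (b 0%N), 0%N|exists (c 0%N)].
exists (sup (range b)) => k.
have h1 : b k <= sup (range b) by apply: sup_upper_bound => //; exists k.
have h2 : sup (range b) <= c k by apply: ge_sup => //; exact: hs.1.
by rewrite ler_norml; move: h1 h2; rewrite /b /c => h1 h2; apply/andP; split; lra.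
Qed.

Lemma row_geometric_limit n (a : nat -> 'rV[R]_n) (C : R) : 0 <= C ->
  (forall k, `|a k.+1 - a k| <= C * 2^-1 ^+ k) ->
  exists l, forall k, `|a k - l| <= 2 * C * 2^-1 ^+ k.
Proof.
move=> C0 ha.
have /choice[l hl] : forall i, exists l, forall k, `|a k 0 i - l| <= 2 * C * 2^-1 ^+ k.
  move=> i; apply: geometric_limit => // k; apply: le_trans (ha k).
  by have := coord_norm (a k.+1 - a k) i; rewrite !mxE.
exists (\row_i l i) => k; apply: row_norm_le => [|i].
  by rewrite !mulr_ge0.
by rewrite !mxE.
Qed.

Lemma geometric_eps (C e : R) : 0 < e -> exists k : nat, C * 2^-1 ^+ k < e.
Proof.
move=> e0.
have h : (fun k : nat => C * 2^-1 ^+ k) @ \oo --> (0 : R).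
  rewrite -(mulr0 C); apply: cvgM; first exact: cvg_cst.
  by apply: cvg_expr; rewrite ger0_norm// invf_lt1// ltr1n.
have := cvgr_lt _ h e e0; case=> N _ hN; exists N; apply: hN => /=.
exact: leqnn.
Qed.

(** Clamping the time turns curves defined on a segment into globally continuous
    ones, which avoids restricting functions to subsets. *)
Definition clamp (lo hi t : R) := Num.max lo (Num.min hi t).

Lemma clamp_itv lo hi t : lo <= hi -> lo <= clamp lo hi t <= hi.
Proof.
by move=> lh; rewrite /clamp le_max lexx/= ge_max lh ge_min lexx.
Qed.

Lemma clampE lo hi t : lo <= t <= hi -> clamp lo hi t = t.
Proof. by move=> /andP[h1 h2]; rewrite /clamp min_r// max_r. Qed.

Lemma clamp_continuous lo hi : continuous (clamp lo hi).
Proof.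
move=> t; apply: (@continuous_max R R (fun=> lo) (fun t => Num.min hi t)).
  exact: cst_continuous.
apply: (@continuous_min R R (fun=> hi) id); first exact: cst_continuous.
exact: cvg_id.
Qed.

(** Picard iteration on the curves that stay within [rho / 2] of [z0].  On an
    interval of half-length [d] with [K * d <= rho / 2] and [L * d <= 1 / 2],
    where [K] bounds [f] near [z0], the operator preserves these curves and
    halves distances; its iterates converge uniformly to a fixed point, which
    solves the equation. *)
Theorem picard n (f : 'rV[R]_n -> 'rV[R]_n) (z0 : 'rV[R]_n) (rho L : R) :
  0 < rho -> 0 <= L ->
  (forall w w', `|w - z0| < rho -> `|w' - z0| < rho ->
     `|f w - f w'| <= L * `|w - w'|) ->
  exists (d : R) (x : R -> 'rV[R]_n), [/\ 0 < d, x 0 = z0 &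
    forall t : R, `|t| < d -> is_derive t (1 : R) x (f (x t)) /\ `|x t - z0| < rho].
Proof.
move=> rho0 L0 fL.
have r20 : 0 < rho / 2 by rewrite divr_gt0.
have r2r : rho / 2 < rho by rewrite ltr_pdivrMr// ltr_pMr// ltr1n.
pose K := `|f z0| + L * rho.
have K0 : 0 <= K by rewrite addr_ge0// mulr_ge0// ltW.
have fK w : `|w - z0| < rho -> `|f w| <= K.
  move=> wr; rewrite -[f w](subrK (f z0)) (le_trans (ler_normD _ _))//.
  rewrite addrC lerD2l (le_trans (fL _ _ wr _)) ?subrr ?normr0//.
  by rewrite ler_wpM2l// ltW.
pose d := Num.min (rho / 2 / (K + 1)) (2^-1 / (L + 1)).
have K1 : 0 < K + 1 by rewrite ltr_wpDl.
have L1 : 0 < L + 1 by rewrite ltr_wpDl.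
have d0 : 0 < d by rewrite lt_min !divr_gt0.
have Kd : K * d <= rho / 2.
  rewrite (@le_trans _ _ ((K + 1) * d))//.
    by rewrite ler_wpM2r ?lerDl// ltW.
  by rewrite mulrC -ler_pdivlMr// /d ge_min lexx.
have Ld : L * d <= 2^-1.
  rewrite (@le_trans _ _ ((L + 1) * d))//.
    by rewrite ler_wpM2r ?lerDl// ltW.
  by rewrite mulrC -ler_pdivlMr// /d ge_min lexx orbT.
pose adm (x : R -> 'rV[R]_n) := continuous x /\ forall t, `|x t - z0| <= rho / 2.
have admr x t : adm x -> `|x t - z0| < rho.
  by move=> [_ hx]; exact: le_lt_trans (hx t) r2r.
have adm_f x : adm x -> continuous (fun t => f (x t)).
  move=> ax t; apply/cvgrPdist_le => e e0.
  near=> s; rewrite (le_trans (fL _ _ (admr _ t ax) (admr _ s ax)))//.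
  rewrite (@le_trans _ _ ((L + 1) * `|x t - x s|))//.
    by rewrite ler_wpM2r// lerDl.
  rewrite -ler_pdivlMl// mulrC; near: s.
  have /cvgrPdist_le := ax.1 t; apply; exact: divr_gt0.
(* one step of the iteration; the primitive lives on a larger interval so that it
   is differentiable at the end points of the clamped time *)
have /choice[next hnext] : forall x, exists x', adm x -> exists U : R -> 'rV[R]_n,
   [/\ U 0 = 0, (forall t : R, `|t| < d * 2 -> is_derive t (1 : R) U (f (x t))) &
    x' = fun t => z0 + U (clamp (- d) d t)].
  move=> x; have [ax|nax] := pselect (adm x); last by exists x.
  have [|U [U0 dU]] := @row_primitive_exists n (fun t => f (x t)) (d * 2) _ (adm_f x ax).
    by rewrite mulr_gt0.
  by exists (fun t => z0 + U (clamp (- d) d t)) => _; exists U.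
have cld t : `|clamp (- d) d t| <= d.
  by rewrite ler_norml; apply: clamp_itv; rewrite ge0_cp ?ltW.
have cl t : `|clamp (- d) d t| < d * 2.
  by rewrite (le_lt_trans (cld t))// mulr_natr mulr2n ltrDl.
have adm_next x : adm x -> adm (next x).
  move=> ax; have [U [U0 dU ->]] := hnext x ax; split => t.
    apply: cvgD; first exact: cvg_cst.
    apply: (@continuous_comp _ _ _ (clamp (- d) d) U); first exact: clamp_continuous.
    apply/differentiable_continuous/derivable1_diffP.
    by have [] := dU _ (cl t).
  rewrite addrC addKr -[U _]subr0 -[X in _ - X]U0.
  have := @primitive_bound n U (fun t => f (x t)) (d * 2) K (clamp (- d) d t) K0 dU _ (cl t).
  move=> /(_ (fun s => fK _ (admr _ s ax))) /le_trans; apply.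
  by apply: le_trans Kd; rewrite ler_wpM2l.
have next_contr x y e : adm x -> adm y -> (forall t, `|x t - y t| <= e) ->
    forall t, `|next x t - next y t| <= 2^-1 * e.
  move=> ax ay xye t.
  have e0 : 0 <= e by exact: le_trans (xye 0).
  have [U [U0 dU ->]] := hnext x ax; have [W [W0 dW ->]] := hnext y ay.
  have -> : z0 + U (clamp (- d) d t) - (z0 + W (clamp (- d) d t))
     = (U - W) (clamp (- d) d t) - (U - W) 0.
    by rewrite -![(U - W) _]/(_ - _) U0 W0 !subr0 opprD addrACA subrr add0r.
  have dUW (s : R) : `|s| < d * 2 -> is_derive s (1 : R) (U - W) (f (x s) - f (y s)).
    by move=> sd; apply: is_deriveB; [exact: dU|exact: dW].
  have LK : 0 <= L * e by rewrite mulr_ge0.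
  have := @primitive_bound n (U - W) (fun s => f (x s) - f (y s)) (d * 2) (L * e)
    (clamp (- d) d t) LK dUW _ (cl t).
  have uK s : `|f (x s) - f (y s)| <= L * e.
    rewrite (le_trans (fL _ _ (admr _ s ax) (admr _ s ay)))//.
    by rewrite ler_wpM2l.
  move=> /(_ uK) /le_trans; apply.
  rewrite (@le_trans _ _ (L * e * d))//.
    by rewrite ler_wpM2l.
  by rewrite mulrAC ler_wpM2r.
pose X k := iter k next (fun=> z0).
have aX k : adm (X k).
  elim: k => [|k IH]; last exact: adm_next.
  by split; [exact: cst_continuous|move=> t; rewrite subrr normr0 ltW].
have XS k t : `|X k.+1 t - X k t| <= rho / 2 * 2^-1 ^+ k.
  elim: k t => [|k IH] t; first by rewrite expr0 mulr1; exact: (aX 1%N).2.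
  by rewrite exprS mulrCA; exact: (next_contr (X k.+1) (X k) _ (aX _) (aX _) IH).
have /choice[x hx] : forall t, exists l, forall k,
    `|X k t - l| <= 2 * (rho / 2) * 2^-1 ^+ k.
  move=> t; apply: (@row_geometric_limit n (fun k => X k t)) => //.
  exact: ltW.
have {}hx t k : `|X k t - x t| <= rho * 2^-1 ^+ k.
  by have := hx t k; rewrite mulrCA divff ?mulr1// pnatr_eq0.
have ax : adm x.
  split => t.
    apply/cvgrPdist_lt => e e0.
    have [|k hk] := @geometric_eps rho (e / 3); first by rewrite divr_gt0.
    near=> s.
    have h1 := le_lt_trans (hx t k) hk; have h2 := le_lt_trans (hx s k) hk.
    have h3 : `|X k t - X k s| < e / 3.
      near: s; have /cvgrPdist_lt := (aX k).1 t; apply.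
      by rewrite divr_gt0.
    have -> : x t - x s = (X k t - X k s) - (X k t - x t) + (X k s - x s).
      by apply/rowP => i; rewrite !mxE; ring.
    rewrite (le_lt_trans (ler_normD _ _))//.
    have := ler_normB (X k t - X k s) (X k t - x t); lra.
  apply/ler_addgt0Pr => e e0.
  have [k hk] := @geometric_eps rho e e0.
  rewrite -(subrKA (X k t)) (le_trans (ler_normD _ _))// addrC lerD//.
    exact: (aX k).2.
  by rewrite distrC (le_trans (hx t k))// ltW.
have nx t : next x t = x t.
  apply/eqP; rewrite -subr_eq0 -normr_eq0 eq_le normr_ge0 andbT.
  apply/ler_addgt0Pr => e e0; rewrite add0r.
  have [k hk] := @geometric_eps rho e e0.
  have h1 : `|next x t - X k.+1 t| <= 2^-1 * (rho * 2^-1 ^+ k).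
    by apply: (next_contr x (X k) _ ax (aX k)) => s; rewrite distrC.
  have h2 := hx t k.+1.
  rewrite -(subrKA (X k.+1 t)) (le_trans (ler_normD _ _))//.
  by move: h2; rewrite exprS mulrCA; lra.
have [U [U0 dU xE]] := hnext x ax.
exists d, x; split => //.
  by rewrite -nx xE clampE ?U0 ?addr0// -ler_norml normr0 ltW.
move=> t td; split; last exact: admr.
have := is_deriveD (is_derive_cst z0 (t : R) (1 : R)) (dU t _).
rewrite add0r (lt_trans td) ?mulr_natr ?mulr2n ?ltrDl// => /(_ isT).
apply: near_eq_is_derive.
near=> s; rewrite -nx xE clampE// -ler_norml.
apply/ltW; near: s.
by have /cvgr_norm_lt := @cvg_id _ (nbhs t); apply.
Unshelve. all: by end_near. Qed.

End Picard.

(** * Existence of geodesics with given initial data *)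

Section GeodesicExistence.
Variables (R : realType) (n : nat) (U : set 'rV[R]_n) (f : TMcoord R n -> R).
Hypothesis oU : open U.
Hypothesis fsm : smooth_on (slit U) f.
Hypothesis fcvx : forall x y, U x -> y != 0 ->
  positive_definite (fundamental_tensor f (x, y)).

(** The spray is a rational expression in derivatives of [f], hence of class
    C^1. *)
Lemma spray_locally_lipschitz z0 : slit U z0 -> exists rho L : R,
  [/\ 0 < rho, 0 <= L, (forall w, `|w - z0| < rho -> slit U w) &
   forall w w', `|w - z0| < rho -> `|w' - z0| < rho ->
     `|spray f w - spray f w'| <= L * `|w - w'|].
Proof.
move=> sz0.
pose P i L r := 0 <= L /\ forall w w', `|w - z0| < r -> `|w' - z0| < r ->
     `|spray f w 0 i - spray f w' 0 i| <= L * `|w - w'|.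
have /choice[L hL] : forall i, exists L : R, \forall r \near (0 : R)^'+, P i L r.
  move=> i.
  have [rho [L [rho0 L0 h]]] := C1_locally_lipschitz (TM_frame R n) (open_slit oU)
    (Ck_spray oU fsm fcvx 1 i) sz0.
  exists L; near=> r; split=> // w w' wr w'r.
  have rr : r <= rho by near: r; exact: nbhs_right_le.
  by apply: h; [exact: lt_le_trans rr|exact: lt_le_trans rr].
have {}hL : \forall r \near (0 : R)^'+, forall i, P i (L i) r by exact: filter_forall.
have [r [r0 hr sr]] : exists r : R, [/\ 0 < r, forall i, P i (L i) r &
    forall w, `|w - z0| < r -> slit U w].
  have : \forall w \near z0, slit U w by exact: open_nbhs_nbhs (conj (open_slit oU) sz0).
  move=> /nbhs_ballP[e /= e0 he].
  near (0 : R)^'+ => r; exists r; split => //; first by near: r.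
  move=> w wr; apply: he; rewrite -ball_normE /= distrC.
  apply: lt_le_trans wr _; near: r; exact: nbhs_right_le.
exists r, (\sum_i L i); split => //.
  by apply: sumr_ge0 => i _; have [] := hr i.
have S0 : 0 <= \sum_i L i by apply: sumr_ge0 => i _; have [] := hr i.
move=> w w' wr w'r; apply: row_norm_le => [|i]; first by rewrite mulr_ge0.
have [_ h] := hr i.
have -> : (spray f w - spray f w') 0 i = spray f w 0 i - spray f w' 0 i.
  by rewrite mxE [X in _ + X]mxE.
rewrite (le_trans (h _ _ wr w'r))// ler_wpM2r// (bigD1 i)//= lerDl sumr_ge0//.
by move=> j _; have [] := hr j.
Unshelve. all: by end_near. Qed.

(** The geodesic equation, as a first order system on the slit tangent bundle
    whose points are encoded as rows of double length. *)
Theorem geodesic_exists x0 y0 : slit U (x0, y0) ->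
  exists (d : R) (x v : R -> 'rV[R]_n), [/\ 0 < d, x 0 = x0, v 0 = y0 &
    forall t : R, `|t| < d -> [/\ is_derive t (1 : R) x (v t),
      is_derive t (1 : R) v (- (2 *: spray f (x t, v t))) & slit U (x t, v t)]].
Proof.
move=> s0; have [rho [L [rho0 L0 sl hL]]] := spray_locally_lipschitz s0.
pose z0 := row_mx x0 y0.
pose pr (w : 'rV[R]_(n + n)) : TMcoord R n := (lsubmx w, rsubmx w).
pose g (w : 'rV[R]_(n + n)) := row_mx (rsubmx w) (- (2 *: spray f (pr w))).
have prB w w' : `|pr w - pr w'| <= `|w - w'|.
  rewrite -[pr w - pr w']/(lsubmx w - lsubmx w', rsubmx w - rsubmx w') pair_norm.
  by rewrite ge_max; apply/andP; split; apply: row_norm_le => // i;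
    [have := coord_norm (w - w') (lshift n i)|have := coord_norm (w - w') (rshift n i)];
    rewrite !mxE.
have prz w : `|w - z0| < rho -> `|pr w - (x0, y0)| < rho.
  have -> : (x0, y0) = pr z0 by rewrite /pr row_mxKl row_mxKr.
  exact: le_lt_trans.
have L20 : 0 <= 1 + 2 * L by rewrite addr_ge0// mulr_ge0.
have gl w j : g w 0 (lshift n j) = w 0 (rshift n j).
  by rewrite /g row_mxEl mxE.
have gr w j : g w 0 (rshift n j) = - (2 * spray f (pr w) 0 j).
  by rewrite /g row_mxEr; move: (spray f (pr w)) => S; rewrite !mxE.
move: g gl gr => g gl gr.
have [|d [z [d0 z00 hz]]] := @picard R _ g z0 rho (1 + 2 * L) rho0 L20.
  move=> w w' wr w'r; apply: row_norm_le => [|i]; first by rewrite mulr_ge0.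
  have -> : (g w - g w') 0 i = g w 0 i - g w' 0 i by rewrite mxE [X in _ + X]mxE.
  case: (split_ordP i) => j ->.
    rewrite (gl w) (gl w') mulrDl mul1r.
    have := coord_norm (w - w') (rshift n j); rewrite mxE [X in _ + X]mxE.
    by move=> /le_trans; apply; rewrite lerDl !mulr_ge0.
  rewrite (gr w) (gr w').
  have := coord_norm (spray f (pr w) - spray f (pr w')) j.
  rewrite mxE [X in _ + X]mxE => h1.
  have h2 := hL _ _ (prz _ wr) (prz _ w'r).
  have h3 := prB w w'.
  have -> : - (2 * spray f (pr w) 0 j) - - (2 * spray f (pr w') 0 j)
    = 2 * (spray f (pr w') 0 j - spray f (pr w) 0 j) by ring.
  rewrite normrM (ger0_norm (_ : 0 <= 2))// distrC. rewrite [leRHS]mulrDl mul1r -[2 * L * _]mulrA.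
  apply: (@le_trans _ _ (2 * (L * `|w - w'|))).
    by rewrite ler_wpM2l// (le_trans h1)// (le_trans h2)// ler_wpM2l.
  by rewrite lerDr.
exists d, (fun t => lsubmx (z t)), (fun t => rsubmx (z t)); split => //.
- by rewrite z00 row_mxKl.
- by rewrite z00 row_mxKr.
move=> t td; have [dz zr] := hz t td; split.
- apply: is_derive_row => i.
  have := is_derive_coord (lshift n i) dz; rewrite gl.
  rewrite mxE; congr is_derive; apply/funext => s; by rewrite mxE.
- apply: is_derive_row => i.
  have := is_derive_coord (rshift n i) dz; rewrite gr.
  have -> : (- (2 *: spray f (pr (z t)))) 0 i = - (2 * spray f (pr (z t)) 0 i).
    by move: (spray f (pr (z t))) => S; rewrite !mxE.
  by congr is_derive; apply/funext => s; rewrite mxE.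
- exact/sl/prz.
Qed.

End GeodesicExistence.

(** * Straight geodesics and the spray in opposite directions *)

Section Lines.
Variables (R : realType) (n : nat).

Lemma row_differentiable (V : normedModType R) (B : frame V) (U : set V)
  (T : V -> 'rV[R]_n) x : open U -> Ck_on 1 U T -> U x -> differentiable T x.
Proof.
move=> oU cT Ux.
have -> : T = \sum_(i < n) (fun y => T y 0 i *: (delta_mx 0 i : 'rV[R]_n)).
  by apply/funext => y; rewrite fct_sumE -row_sum_delta.
apply: differentiable_sum => i; apply: differentiableZl.
exact: (C1_differentiable B oU (Ck_coord oU i cT)).
Qed.

(** With [v 0 j != 0], the functions [v 0 j * f i - v 0 i * f j] are constant on
    the line, so their derivatives vanish. *)
Lemma derive_collinear (f : R -> 'rV[R]_n) (q v w : 'rV[R]_n) (t : R) :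
  v != 0 -> (\forall u \near t, exists s, f u = q + s *: v) ->
  is_derive t (1 : R) f w -> exists m, w = m *: v.
Proof.
move=> v0 fq df.
have [j vj] := row_neq0 v0.
exists (w 0 j / v 0 j); apply/rowP => i; rewrite mxE mulrAC.
apply: (mulIf vj); rewrite divfK//.
have di := is_derive_coord i df; have dj := is_derive_coord j df.
have d1 := is_deriveB (is_deriveZ (v 0 j) di) (is_deriveZ (v 0 i) dj).
have d2 : is_derive t (1 : R)
   ((v 0 j \*: (fun s => f s 0 i)) - (v 0 i \*: (fun s => f s 0 j))) 0.
  apply: near_eq_is_derive (is_derive_cst (v 0 j * q 0 i - v 0 i * q 0 j) t (1 : R)).
  move: fq; apply: filterS => u [s us].
  rewrite -[RHS]/(v 0 j * f u 0 i - v 0 i * f u 0 j) us !mxE /cst; ring.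
have := @derive_val _ _ _ _ _ _ _ d2; rewrite (@derive_val _ _ _ _ _ _ _ d1).
rewrite -[LHS]/(v 0 j * w 0 i - v 0 i * w 0 j) => /eqP; rewrite subr_eq0 => /eqP.
by rewrite mulrC => ->; rewrite mulrC.
Qed.

(** The second differential of [T] at [x], evaluated on [(v, v)]. *)
Definition hess (T : 'rV[R]_n -> 'rV[R]_n) (x v : 'rV[R]_n) : 'rV[R]_n :=
  \row_i \sum_j v 0 j * 'D_v ('D_(delta_mx 0 j) (fun z => T z 0 i)) x.

Lemma hessE T x v i : hess T x v 0 i =
  \sum_j v 0 j * 'D_v ('D_(delta_mx 0 j) (fun z => T z 0 i)) x.
Proof. by rewrite /hess mxE. Qed.

Section Smooth.
Variables (W : set 'rV[R]_n) (T : 'rV[R]_n -> 'rV[R]_n).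
Hypotheses (oW : open W) (sT : smooth_on W T).

Let diffT x : W x -> differentiable T x.
Proof. exact: (row_differentiable (row_frame R n) oW (sT 1)). Qed.

Let diffdT x i j : W x ->
  differentiable ('D_(delta_mx 0 j) (fun z => T z 0 i)) x.
Proof.
apply: (C1_differentiable (row_frame R n) oW).
by have [_ h] := Ck_coord oW i (sT 2); have [] := h (delta_mx 0 j).
Qed.

(** Quadratic in [v], hence even: this is why the change to straight coordinates
    contributes the same term to a geodesic and to the one starting
    backwards. *)
Lemma hessN x v : W x -> hess T x (- v) = hess T x v.
Proof.
move=> Wx; apply/rowP => i.
apply: etrans (hessE _ _ _ _) _; apply: etrans _ (esym (hessE _ _ _ _)).
apply: eq_bigr => j _.
rewrite (deriveNdir _ (diffdT i j Wx)).
have -> : (- v) 0 j = - v 0 j by rewrite mxE.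
exact: mulrNN.
Qed.

Lemma derive_comp1 (x : R -> 'rV[R]_n) t v : W (x t) ->
  is_derive t (1 : R) x v -> is_derive t (1 : R) (fun s => T (x s)) ('D_v T (x t)).
Proof. by move=> Wx; apply: is_derive_comp_curve; exact: diffT. Qed.

Lemma derive_comp2 (x v : R -> 'rV[R]_n) t a : W (x t) ->
  is_derive t (1 : R) x (v t) -> is_derive t (1 : R) v a ->
  (\forall u \near t, W (x u)) ->
  is_derive t (1 : R) (fun s => 'D_(v s) T (x s)) ('D_a T (x t) + hess T (x t) (v t)).
Proof.
move=> Wx dx dv nW.
have DT y w i : W y ->
    ('D_w T y) 0 i = \sum_j w 0 j * 'D_(delta_mx 0 j) (fun z => T z 0 i) y.
  move=> Wy; rewrite derive_mx; last exact/diff_derivable/diffT.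
  rewrite mxE; have dTi := C1_differentiable (row_frame R n) oW (Ck_coord oW i (sT 1)) Wy.
  rewrite deriveE// {1}(row_sum_delta w) linear_sum; apply: eq_bigr => j _.
  by rewrite linearZ deriveE.
apply: is_derive_row => i.
have -> : ('D_a T (x t) + hess T (x t) (v t)) 0 i =
  \sum_j (v t 0 j *: 'D_(v t) ('D_(delta_mx 0 j) (fun z => T z 0 i)) (x t) +
     'D_(delta_mx 0 j) (fun z => T z 0 i) (x t) *: a 0 j).
  rewrite mxE (hessE T (x t)) DT// -big_split/=; apply: eq_bigr => j _.
  by rewrite addrC [X in _ + X]mulrC.
have : is_derive t (1 : R) (fun s => \sum_j v s 0 j *
     'D_(delta_mx 0 j) (fun z => T z 0 i) (x s))
  (\sum_j (v t 0 j *: 'D_(v t) ('D_(delta_mx 0 j) (fun z => T z 0 i)) (x t) +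
     'D_(delta_mx 0 j) (fun z => T z 0 i) (x t) *: a 0 j)).
  apply: is_derive_sumr => j; apply: is_deriveM; first exact: is_derive_coord.
  by apply: is_derive_comp_curve => //; exact: diffdT.
apply: near_eq_is_derive; move: nW; apply: filterS => s Ws.
by rewrite DT.
Qed.

(** Differentiate [S (T (x + s *: h)) = x + s *: h] at [s = 0]. *)
Lemma derive_inj (S : 'rV[R]_n -> 'rV[R]_n) x h : W x ->
  differentiable S (T x) -> (forall y, W y -> S (T y) = y) ->
  'D_h T x = 0 -> h = 0.
Proof.
move=> Wx dS ST Th0.
have d1 : is_derive (0 : R) (1 : R) (fun s => T (x + s *: h)) 0.
  by rewrite -Th0; exact/is_derive_line0/diffT.
have d2 : is_derive (0 : R) (1 : R) (fun s => S (T (x + s *: h))) ('D_0 S (T x)).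
  have := @is_derive_comp_curve R _ _ S (fun s => T (x + s *: h)) 0 0.
  by rewrite scale0r addr0 => h1; exact: h1.
have d3 : is_derive (0 : R) (1 : R) (fun s : R => x + s *: h) h.
  by have := @is_derive_line0 R _ _ id x h; rewrite derive_id => h1; apply: h1.
rewrite -(@derive_val _ _ _ _ _ _ _ d3) -[RHS](derive0 S (T x)).
rewrite -(@derive_val _ _ _ _ _ _ _ d2); apply: near_eq_derive.
have := near_line h oW Wx.
by apply: filterS => s Ws; rewrite ST.
Qed.

End Smooth.
End Lines.

Section Flat.
Variables (R : realType) (n : nat) (M : smooth_manifold R n) (F : TMfun M).
Hypotheses (FF : finsler F) (flat : projectively_flat F).

(** The geodesic equation for [X], given its velocity as an explicit function
    rather than as [derive1 X]. *)
Lemma solves_geodesicI (f : TMcoord R n -> R) (X V : R -> 'rV[R]_n) s :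
  (\forall u \near s, is_derive u (1 : R) X (V u)) ->
  is_derive s (1 : R) V (- (2 *: spray f (X s, V s))) -> V s != 0 ->
  solves_geodesic_eq f X s.
Proof.
move=> dX dV V0.
have XV : \forall u \near s, V u = derive1 X u.
  by move: dX; apply: filterS => u [_]; rewrite derive1E.
have XVs := nbhs_singleton XV.
have [d2 d2E] := near_eq_is_derive XV dV.
split; [by have [] := nbhs_singleton dX|exact: d2|by rewrite -XVs|].
by rewrite derive1E d2E XVs addNr.
Qed.

Lemma overlap_open (c c' : chart R n M) :
  open (cmap c @` (cdom c `&` cdom c')).
Proof.
rewrite openE => _ [p [cp c'p] <-]; rewrite /interior.
have nx : nbhs (cmap c p) (cimg c).
  by apply: open_nbhs_nbhs; split; [exact: cimg_open|exists p].
have nc : \forall x \near cmap c p, cdom c' (cinv c x).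
  apply: (@cinv_continuous _ _ _ c); first by exists p.
  rewrite cmapK//; apply: open_nbhs_nbhs; split => //; exact: cdom_open.
move: nx nc; apply: filterS2 => _ [q cq <-]; rewrite cmapK// => c'q.
by exists q.
Qed.

(** Run the geodesic with initial data [(x0, y0)] in the chart [c0].  Read in the
    flat chart it moves on a straight line, so there its first and second
    derivatives at time 0 are parallel.  By the chain rule the second one is
    the left-hand side, the acceleration of the geodesic in [c0] being
    [- (2 *: spray (F c0) (x0, y0))]. *)
Lemma flat_second_order (c0 c : chart R n M) (x0 y0 : 'rV[R]_n) :
  atlas c0 -> atlas c ->
  (forall (a b : R) (g : R -> M), a < b -> geodesic F a b g ->
      (forall t : R, a <= t <= b -> cdom c (g t)) ->
      in_straight_line a b (fun t => cmap c (g t))) ->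
  (cmap c0 @` (cdom c0 `&` cdom c)) x0 -> y0 != 0 ->
  let T := transition c0 c in
  'D_y0 T x0 != 0 ->
  exists k, 'D_(- (2 *: spray (F c0) (x0, y0))) T x0 + hess T x0 y0
    = k *: 'D_y0 T x0.
Proof.
move=> ac0 ac lin W0 y0n T Ty0.
set W := cmap c0 @` _ in W0.
have oW : open W by exact: overlap_open.
have sT : smooth_on W T by have [] := atlas_compatible ac0 ac.
have oU : open (cimg c0) by exact: cimg_open.
have U0 : cimg c0 x0 by case: W0 => p [cp _] <-; exists p.
have s0 : slit (cimg c0) (x0, y0) by [].
have [d [x [v [d0 xx0 vy0 hxv]]]] := geodesic_exists oU
  (finsler_smooth FF ac0) (fun x y => finsler_convex FF ac0) s0.
have hx0 := hxv 0; rewrite normr0 in hx0.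
have {hx0}[dx0 dv0 _] := hx0 d0.
have : \forall t \near (0 : R), W (x t).
  have cx : {for (0 : R), continuous x}.
    by apply/differentiable_continuous/derivable1_diffP; case: dx0.
  by apply: cx; rewrite xx0; exact: open_nbhs_nbhs.
move=> /nbhs_ballP[d1 /= d10 hd1].
pose e := Num.min d d1 / 2.
have md : 0 < Num.min d d1 by rewrite lt_min d0.
have e0 : 0 < e by rewrite divr_gt0.
have em : e < Num.min d d1 by rewrite ltr_pdivrMr// ltr_pMr// ltr1n.
have dd (t : R) : `|t| < Num.min d d1 -> `|t| < d by rewrite lt_min => /andP[].
have Wd (t : R) : `|t| < Num.min d d1 -> W (x t).
  rewrite lt_min => /andP[_ t1]; apply: hd1.
  by rewrite -ball_normE /= sub0r normrN.
pose g u := cinv c0 (x u).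
have gE (t : R) : `|t| < Num.min d d1 -> [/\ cdom c0 (g t), cdom c (g t) & cmap c0 (g t) = x t].
  by move=> /Wd[p [p0 p1] pE]; rewrite /g -pE cmapK.
have near_in (t : R) : `|t| < Num.min d d1 -> \forall s \near t, `|s| < Num.min d d1.
  by move=> td; have /cvgr_norm_lt := @cvg_id _ (nbhs t); apply.
have geo : geodesic F (- e) e g.
  move=> t; rewrite -ler_norml => te; exists c0 => //.
  have := near_in t (le_lt_trans te em); apply: filterS => s sd.
  split; first by have [] := gE s sd.
  have near_s := near_in s sd.
  have xs : \forall u \near s, x u = cmap c0 (g u).
    by move: near_s; apply: filterS => u ud; have [] := gE u ud.
  have [dxs dvs [_ /= vs0]] := hxv s (dd s sd).
  have solves := @solves_geodesicI (F c0) (fun u => cmap c0 (g u)) v s.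
  refine (solves _ _ vs0).
    have := near_join near_s; apply: filterS => u.
    move=> near_u; have ud := nbhs_singleton near_u.
    have [dxu _ _] := hxv u (dd u ud).
    apply: near_eq_is_derive dxu; move: near_u; apply: filterS => r rd.
    by have [] := gE r rd.
  by have [_ _ ->] := gE s sd.
have [||q [w [w0 hq]]] := lin (- e) e g _ geo _.
- by rewrite gtrN.
- by move=> t; rewrite -ler_norml => te; have [] := gE t (le_lt_trans te em).
have nTx : \forall t \near (0 : R), exists k, T (x t) = q + k *: w.
  have : \forall t \near (0 : R), `|t| < e.
    by have /cvgr_norm_lt := @cvg_id _ (nbhs (0 : R)); apply; rewrite normr0.
  by apply: filterS => t te; apply: hq; rewrite -ler_norml; exact: ltW.
have Wx0 : W (x 0) by rewrite xx0.
have near0 : \forall t \near (0 : R), `|t| < Num.min d d1.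
  by apply: near_in; rewrite normr0.
have nW : \forall t \near (0 : R), W (x t).
  by move: near0; apply: filterS => t /Wd.
have D1 (t : R) : `|t| < Num.min d d1 ->
    is_derive t (1 : R) (fun s => T (x s)) ('D_(v t) T (x t)).
  move=> td; have [dxt _ _] := hxv t (dd t td).
  by apply: (derive_comp1 oW sT) => //; exact: Wd.
have D2 := derive_comp2 oW sT Wx0 dx0 dv0 nW.
have par1 : \forall t \near (0 : R), exists k, 'D_(v t) T (x t) = 0 + k *: w.
  have := near_join nTx; apply: filterS2 near0 => t td nt.
  by have [k kE] := derive_collinear w0 nt (D1 t td); exists k; rewrite add0r.
have [nu nuE] := derive_collinear w0 par1 D2.
have [mu muE] := nbhs_singleton par1; rewrite add0r in muE.
rewrite xx0 vy0 in nuE muE.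
have mu0 : mu != 0 by apply: contraNneq Ty0 => m0; rewrite muE m0 scale0r.
by exists (nu / mu); rewrite nuE muE scalerA divfK.
Qed.

(** Compare [flat_second_order] for [y0] and [- y0]: the Hessian terms agree and
    cancel, so the differential of the transition map sends the difference of
    the two sprays to a multiple of the image of [y0]; it is injective. *)
Lemma spray_odd_part (c0 : chart R n M) (x0 y0 : 'rV[R]_n) : atlas c0 ->
  cimg c0 x0 -> y0 != 0 ->
  exists k, spray (F c0) (x0, - y0) - spray (F c0) (x0, y0) = k *: y0.
Proof.
move=> ac0 [p cp px] y0n.
have [c [ac ccp lin]] := flat p.
have W0 : (cmap c0 @` (cdom c0 `&` cdom c)) x0 by exists p.
have oW : open (cmap c0 @` (cdom c0 `&` cdom c)) by exact: overlap_open.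
set W := cmap c0 @` _ in W0 oW.
have [sT sS] := atlas_compatible ac0 ac.
set T := transition c0 c in sT; set S := transition c c0 in sS.
have dT : differentiable T x0 := row_differentiable (row_frame R n) oW (sT 1%N) W0.
have inj h : 'D_h T x0 = 0 -> h = 0.
  apply: (derive_inj oW sT (S := S)) => //.
    have oW' : open (cmap c @` (cdom c0 `&` cdom c)).
      by rewrite setIC; exact: overlap_open.
    apply: (row_differentiable (row_frame R n) oW' (sS 1%N)).
    by exists p => //; rewrite /T /transition /= -px cmapK.
  by move=> _ [r [r0 r1] <-]; rewrite /S /T /transition /= !cmapK.
have Ty : 'D_y0 T x0 != 0 by apply: contraNneq y0n => /inj ->.
have TyN : 'D_(- y0) T x0 != 0 by rewrite deriveNdir// oppr_eq0.
have y0N : - y0 != 0 by rewrite oppr_eq0.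
have [k1] := flat_second_order ac0 ac lin W0 y0n Ty.
have [k2] := flat_second_order ac0 ac lin W0 y0N TyN.
rewrite (hessN oW sT)// -/T.
move: (spray (F c0) (x0, - y0)) (spray (F c0) (x0, y0)) (hess T x0 y0) => G2 G1 H.
rewrite (deriveNdir y0 dT) !(deriveE _ dT) => e2 e1.
exists ((k1 + k2) / 2).
apply/eqP; rewrite -subr_eq0; apply/eqP.
have two : (2 : R) != 0 by rewrite pnatr_eq0.
apply: (scalerI two); rewrite scaler0; apply: inj; rewrite deriveE//.
have -> : 2 *: (G2 - G1 - ((k1 + k2) / 2) *: y0)
  = - (2 *: G1) - (- (2 *: G2)) - (k1 + k2) *: y0.
  by apply/rowP => i; rewrite !mxE; field.
have dl A B k : 'd T x0 (A - B - k *: y0)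
    = 'd T x0 A - 'd T x0 B - k *: 'd T x0 y0.
  by rewrite linearB linearB linearZ.
rewrite dl.
have -> : 'd T x0 (- (2 *: G1)) = k1 *: 'd T x0 y0 - H by rewrite -e1 addrK.
have -> : 'd T x0 (- (2 *: G2)) = k2 *: - 'd T x0 y0 - H by rewrite -e2 addrK.
move: ('d T x0 y0) => D; apply/rowP => i; rewrite !mxE; ring.
Qed.

End Flat.

(** * Reparametrization with prescribed speed *)

Section Reparametrization.
Variable R : realType.

Lemma is_derive_continuous (f : R -> R) (t a : R) :
  is_derive t (1 : R) f a -> {for t, continuous f}.
Proof. by move=> [d _]; exact/differentiable_continuous/derivable1_diffP. Qed.

(** The points of [[0, 1]] satisfy [P] themselves, so a common margin is only
    needed at the two end points. *)
Lemma collar (P : R -> Prop) : (forall t : R, 0 <= t <= 1 -> \forall s \near t, P s) ->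
  exists2 e : R, 0 < e & forall s : R, - e <= s <= 1 + e -> P s.
Proof.
move=> hP.
have /hP/nbhs_ballP[e0 /= e00 h0] : 0 <= (0 : R) <= 1 by rewrite lexx ler01.
have /hP/nbhs_ballP[e1 /= e10 h1] : 0 <= (1 : R) <= 1 by rewrite lexx ler01.
pose e := Num.min e0 e1 / 2.
have m0 : 0 < Num.min e0 e1 by rewrite lt_min e00.
have : e < Num.min e0 e1 by rewrite ltr_pdivrMr// ltr_pMr// ltr1n.
rewrite lt_min => /andP[ee0 ee1].
have ep : 0 < e by rewrite divr_gt0.
exists e => // s /andP[s1 s2].
have [s0|s0] := ltP s 0.
  apply: h0; rewrite -ball_normE /= sub0r normrN ltr0_norm//.
  by rewrite (le_lt_trans _ ee0)// lerNl.
have [s3|s3] := leP s 1; first by apply: nbhs_singleton (hP s _); rewrite s0.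
apply: h1; rewrite -ball_normE /= distrC ger0_norm ?subr_ge0 ?ltW//.
by rewrite (le_lt_trans _ ee1)// lerBlDl.
Qed.

(** Solve [phi' = C / H (1 - phi)] by separating variables: [phi t] is the inverse
    of a primitive [Th] of [s |-> H (1 - s)], evaluated at [C * t], and
    [C = Th 1] makes [phi 1 = 1]. *)
Lemma reparametrization_by_speed (H : R -> R) :
  (forall t : R, 0 <= t <= 1 -> \forall s \near t, 0 < H s /\ {for s, continuous H}) ->
  exists C phi, [/\ 0 < C, reparametrization phi,
    (forall t : R, 0 <= t <= 1 -> 0 <= phi t <= 1) &
    forall t : R, 0 <= t <= 1 -> \forall s \near t,
      is_derive s (1 : R) phi (C / H (1 - phi s))].
Proof.
move=> /collar[e e0 hH].
have ee : - e <= 1 + e by lra.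
pose cl : R -> R := clamp (- e) (1 + e).
have cl_in s : - e <= cl s <= 1 + e := clamp_itv s ee.
have cl_cont : continuous cl by exact: clamp_continuous.
pose K (s : R) := H (cl (1 - s)).
have cK : continuous K.
  move=> s; apply: (@continuous_comp _ _ _ (fun s : R => cl (1 - s)) H).
    apply: (@continuous_comp _ _ _ (fun s : R => 1 - s) cl); last exact: cl_cont.
    by apply: cvgB; [exact: cvg_cst|exact: cvg_id].
  by have [] := hH _ (cl_in (1 - s)).
have K0 s : 0 < K s by have [] := hH _ (cl_in (1 - s)).
have T0 : 0 < 2 + e by rewrite addr_gt0.
have [Th [Th0 dTh]] := primitive_exists T0 cK.
have inT s : - e <= s <= 1 + e -> `|s| < 2 + e.
  by move=> /andP[s1 s2]; rewrite ltr_norml; apply/andP; split; lra.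
have dTh' s : - e <= s <= 1 + e -> is_derive s (1 : R) Th (K s).
  by move=> /inT; exact: dTh.
have cTh s : - e <= s <= 1 + e -> {for s, continuous Th}.
  by move=> /dTh'; exact: is_derive_continuous.
have incr : {in `[- e, 1 + e] &, {homo Th : x y / x < y}}.
  apply: gtr0_derive1_lt_cc.
  - by move=> x /subset_itv_oo_cc; rewrite in_itv/= => /dTh'[].
  - move=> x /subset_itv_oo_cc; rewrite in_itv/= => /dTh'[_ h].
    by rewrite derive1E h.
  - apply: derivable_within_continuous => x; rewrite in_itv/=.
    by move=> /dTh'[].
have mono : {in `[- e, 1 + e] &, {mono Th : x y / x <= y}} by apply: le_mono_in.
have inj : {in `[- e, 1 + e] &, injective Th} by apply: inc_inj_in.
have in0 : 0 \in `[- e, 1 + e] by rewrite in_itv/= oppr_le0 addr_ge0 ?ltW.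
have in1 : 1 \in `[- e, 1 + e] by rewrite in_itv/= lerDl; apply/andP; split; lra.
(* [Th] is only controlled on the collar, so its inverse is taken there *)
pose inv y := xget 0 [set x | x \in `[- e, 1 + e] /\ Th x = y].
have invK x : x \in `[- e, 1 + e] -> inv (Th x) = x.
  move=> xe; have [|ie iE] := @xgetPex _ 0 [set x' | x' \in `[- e, 1 + e] /\ Th x' = Th x].
    by exists x.
  exact: inj ie xe iE.
pose C := Th 1.
have C0 : 0 < C by rewrite /C -Th0 incr.
pose phi t := inv (C * t).
have phi_ex t : 0 <= t <= 1 -> exists x, [/\ 0 <= x <= 1, Th x = C * t & phi t = x].
  move=> /andP[t0 t1].
  have [||x x01 xE] := @IVT R Th 0 1 (C * t) ler01.
  - apply: continuous_in_subspaceT => s /[1!inE]/=; rewrite in_itv/=.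
    by move=> /andP[s0 s1]; apply: cTh; apply/andP; split; lra.
  - have C0' := ltW C0.
    rewrite -/C Th0 (min_l C0') (max_r C0') mulr_ge0//=.
    by rewrite ler_piMr.
  exists x; split => //; rewrite /phi -xE invK//.
  by move: x01; rewrite !in_itv/= => /andP[x0 x1]; apply/andP; split; lra.
have nearphi (t : R) : 0 <= t <= 1 -> \forall s \near t,
    Th (phi s) = C * s /\ - e < phi s < 1 + e.
  move=> /phi_ex[x [/andP[x0 x1] xE px]].
  have xe : - e < x < 1 + e by apply/andP; split; lra.
  have near_e (y : R) : - e < y < 1 + e -> \forall s \near y, - e < s < 1 + e.
    move=> ye; have : \forall s \near y, s \in `]- e, 1 + e[ by exact: near_in_itvoo.
    by apply: filterS => s; rewrite in_itv.
  have near_can : {near x, cancel Th inv}.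
    have := near_e x xe; apply: filterS => s /andP[s1 s2].
    by apply: invK; rewrite in_itv/= !ltW.
  have near_cont : {near x, continuous Th}.
    have := near_e x xe; apply: filterS => s /andP[s1 s2].
    by apply: cTh; rewrite !ltW.
  have sc : {for t, continuous (fun s : R => C * s)}.
    by apply: cvgM; [exact: cvg_cst|exact: cvg_id].
  have h1 : \forall y \near Th x, Th (inv y) = y := near_continuous_can_sym near_cont near_can.
  have h2 : \forall y \near Th x, - e < inv y < 1 + e.
    have ci : {for Th x, continuous inv}.
      exact: nbhs_singleton (near_can_continuous near_can near_cont).
    have nb : nbhs (inv (Th x)) [set y | - e < y < 1 + e].
      rewrite invK; first exact: near_e.
      by move/andP: xe => [y1 y2]; rewrite in_itv/= !ltW.
    exact: (ci _ nb).
  rewrite xE in h1 h2.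
  have h1' : \forall s \near t, Th (phi s) = C * s by exact: (sc _ h1).
  have h2' : \forall s \near t, - e < phi s < 1 + e by exact: (sc _ h2).
  by move: h1' h2'; apply: filterS2.
have dphi (t : R) : 0 <= t <= 1 -> \forall s \near t,
      is_derive s (1 : R) phi (C / H (1 - phi s)).
  move=> /nearphi; apply: filterS => s [xE xe].
  move: (phi s) xE xe => x xE xe.
  have xin (y : R) : - e < y < 1 + e -> - e <= y <= 1 + e.
    by move=> /andP[y1 y2]; rewrite !ltW.
  have near_e : \forall y \near x, - e < y < 1 + e.
    have : \forall y \near x, y \in `]- e, 1 + e[ by exact: near_in_itvoo.
    by apply: filterS => y; rewrite in_itv.
  have KE : K x = H (1 - x).
    by rewrite /K /cl clampE//; move/andP: xe => [y1 y2]; apply/andP; split; lra.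
  have dinv : is_derive (C * s) (1 : R) inv (K x)^-1.
    rewrite -xE; apply: (@is_derive_inverse R Th inv (K x) x).
    - move: near_e; apply: filterS => y ye; apply: invK; rewrite in_itv/=.
      exact: xin.
    - by move: near_e; apply: filterS => y ye; apply: cTh; exact: xin.
    - exact/dTh'/xin.
    - by rewrite gt_eqF.
  have dsc : is_derive s (1 : R) (fun s : R => C * s) C.
    by have := is_deriveZ C (is_derive_id (s : R) (1 : R)); rewrite [_ *: 1]mulr1.
  have := is_derive1_comp dinv dsc.
  by rewrite mulrC KE.
have near_good (t : R) : 0 <= t <= 1 -> \forall s \near t,
    0 < H (1 - phi s) /\ {for 1 - phi s, continuous H}.
  move=> /nearphi; apply: filterS => s [_ /andP[s1 s2]].
  by apply: hH; apply/andP; split; lra.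
exists C, phi; split => //; last first.
  by move=> t /phi_ex[x [x01 _ ->]].
split.
- by rewrite /phi mulr0 -Th0 invK.
- by rewrite /phi mulr1 invK.
move=> t t01; have n1 := near_join (dphi t t01); have n2 := near_good t t01.
move: n1 n2; apply: filterS2 => s ns [Hs cs].
have ds := nbhs_singleton ns; have [dps dpE] := ds.
have near_d1 : \forall u \near s, C / H (1 - phi u) = derive1 phi u.
  by move: ns; apply: filterS => u [_ h]; rewrite derive1E.
split; [exact: dps| |by rewrite -(nbhs_singleton near_d1) divr_gt0].
rewrite /prop_for /continuous_at -(nbhs_singleton near_d1).
apply: cvg_trans (near_eq_cvg near_d1) _.
apply: cvgM; first exact: cvg_cst.
apply: cvgV; first by rewrite gt_eqF.
apply: (@continuous_comp _ _ _ (fun u : R => 1 - phi u) H) => //.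
by apply: cvgB; [exact: cvg_cst|exact: is_derive_continuous ds].
Qed.

End Reparametrization.

(** * Reversal of geodesics *)

Section Reversal.
Variables (R : realType) (n : nat) (M : smooth_manifold R n) (F : TMfun M).
Hypotheses (FF : finsler F) (flat : projectively_flat F).
Variable g : R -> M.

Definition chart_at (p : M) : chart R n M := s2val (cid2 (atlas_cover p)).

Lemma chart_at_atlas p : atlas (chart_at p).
Proof. exact: s2valP (cid2 (atlas_cover p)). Qed.

Lemma chart_at_dom p : cdom (chart_at p) p.
Proof. exact: s2valP' (cid2 (atlas_cover p)). Qed.

(** The [F]-length of the reversed velocity of [g].  It is a scalar, so it does
    not depend on the chart and makes sense along the whole curve; the
    reversed curve has constant [F]-speed exactly when its parameter is
    proportional to the integral of this function. *)
Definition backward_speed (s : R) : R :=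
  let c := chart_at (g s) in
  F c (cmap c (g s), - derive1 (fun u => cmap c (g u)) s).

(** Transition maps send velocities to velocities, and [F] is well defined on the
    tangent bundle. *)
Lemma backward_speedE (c : chart R n M) (s : R) : atlas c ->
  (\forall u \near s, cdom c (g u)) ->
  derivable (fun u => cmap c (g u)) s 1 ->
  backward_speed s = F c (cmap c (g s), - derive1 (fun u => cmap c (g u)) s).
Proof.
move=> ac nc dX; have cs := nbhs_singleton nc.
rewrite /backward_speed; set c' := chart_at (g s).
have ac' : atlas c' := chart_at_atlas (g s).
have c's : cdom c' (g s) := chart_at_dom (g s).
rewrite -(finsler_TM FF _ ac ac' cs c's); congr (F c' (_, _)).
have W0 : (cmap c @` (cdom c `&` cdom c')) (cmap c (g s)) by exists (g s).
have oW : open (cmap c @` (cdom c `&` cdom c')) by exact: overlap_open.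
have [sT _] := atlas_compatible ac ac'.
have dT := row_differentiable (row_frame R n) oW (sT 1%N) W0.
rewrite /tangent_map (deriveNdir _ dT); congr (- _).
have dXs : is_derive s (1 : R) (fun u => cmap c (g u))
    (derive1 (fun u => cmap c (g u)) s).
  by split; [exact: dX|rewrite derive1E].
have := @is_derive_comp_curve R _ _ (transition c c') (fun u => cmap c (g u)) s _ dT dXs.
move=> /near_eq_is_derive h; rewrite derive1E.
apply: (@derive_val _ _ _ _ _ _ _ (h _ _)).
move: nc; apply: filterS => u cu.
by rewrite /transition /= cmapK.
Qed.

(** Write [G(x, - x') = G(x, x') + k x'] for the spray [G].  Along [g] the vector
    [(x', - x'')] is [(x', 2 G(x, x'))], that is the opposite of
    [(- x', - 2 G(x, - x'))] plus [2 k (0, - x')].  Differentiating [F] at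
    [(x, - x')], the former contributes nothing by [spray_conserves] and the
    latter contributes [2 k F] by Euler's identity. *)
Lemma backward_speed_ode (c : chart R n M) (s : R) : atlas c ->
  (\forall u \near s, cdom c (g u) /\
     solves_geodesic_eq (F c) (fun u => cmap c (g u)) u) ->
  let X := fun u => cmap c (g u) in
  exists k, [/\ 0 < backward_speed s,
    spray (F c) (X s, - derive1 X s) - spray (F c) (X s, derive1 X s) = k *: derive1 X s &
    is_derive s (1 : R) backward_speed (2 * k * backward_speed s)].
Proof.
move=> ac ns X; have [cs [dX ddX X0 XE]] := nbhs_singleton ns.
have U0 : cimg c (X s) by exists (g s).
have [k kE] := spray_odd_part FF flat ac U0 X0.
have nE : \forall u \near s, F c (X u, - derive1 X u) = backward_speed u.
  have := near_join ns; apply: filterS => u nu.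
  have [_ [dXu _ _ _]] := nbhs_singleton nu.
  rewrite (backward_speedE ac)//.
  by move: nu; apply: filterS => r [].
have nEs := nbhs_singleton nE.
have oU : open (cimg c) by exact: cimg_open.
have XN0 : - derive1 X s != 0 by rewrite oppr_eq0.
have sl : slit (cimg c) (X s, - derive1 X s) by [].
exists k; split; [|exact: kE|].
  by rewrite -nEs; exact: (finsler_pos FF ac U0 XN0).
apply: near_eq_is_derive nE _; rewrite -nEs.
have fhom x y (k' : R) (Ux : cimg c x) (k0 : 0 < k') :
    F c (x, k' *: y) = k' * F c (x, y) := finsler_homogeneous FF y ac Ux k0.
have dF := slit_differentiable oU (finsler_smooth FF ac 1%N) sl.
have dXs : is_derive s (1 : R) X (derive1 X s).
  by split; [exact: dX|rewrite derive1E].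
have dXXs : is_derive s (1 : R) (derive1 X) (derive1 (derive1 X) s).
  by split; [exact: ddX|rewrite derive1E].
pose Z (u : R) : TMcoord R n := (X u, - derive1 X u).
have dZ : is_derive s (1 : R) Z ((derive1 X s, - derive1 (derive1 X) s) : TMcoord R n).
  exact: (is_derive_pair dXs (is_deriveN dXXs)).
suff vE : 'D_((derive1 X s, - derive1 (derive1 X) s) : TMcoord R n)
    (F c) (X s, - derive1 X s) = 2 * k * F c (X s, - derive1 X s).
  by rewrite -vE; exact: (@is_derive_comp_curve R _ _ (F c) Z s _ dF dZ).
have cons := spray_conserves oU fhom (finsler_smooth FF ac)
  (fun x y => @finsler_pos _ _ _ _ FF c x y ac) (fun x y => @finsler_convex _ _ _ _ FF c x y ac) sl.
have eul := euler_f oU fhom (finsler_smooth FF ac) sl.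
rewrite -[in RHS]eul (deriveE _ dF) (deriveE _ dF).
move: cons; rewrite (deriveE _ dF).
have -> : derive1 (derive1 X) s = - (2 *: spray (F c) (X s, derive1 X s)).
  by apply/eqP; rewrite -addr_eq0; apply/eqP.
have -> : spray (F c) (X s, derive1 X s)
    = spray (F c) (X s, - derive1 X s) - k *: derive1 X s.
  by rewrite -kE opprB addrC subrK.
have vec (G Y : 'rV[R]_n) : ((Y, - - (2 *: (G - k *: Y))) : TMcoord R n) =
   (2 * k) *: ((0, - Y) : TMcoord R n) - ((- Y, - (2 *: G)) : TMcoord R n).
  rewrite -[RHS]/((2 * k) *: 0 - - Y, (2 * k) *: - Y - - (2 *: G)).
  by congr (_, _); apply/rowP => i; rewrite !mxE; ring.
by move=> cons; rewrite vec linearB linearZ /= cons subr0.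
Qed.

(** Parametrize the reversed curve by [phi' = C / H(1 - phi)], where [H] is the
    backward speed.  Then [phi'' = 2 k phi'^2] by [backward_speed_ode], which
    is exactly what compensates the difference [k x'] between the sprays in the
    directions [x'] and [- x']. *)
Lemma reverse_geodesic : geodesic F 0 1 g ->
  exists2 phi : R -> R, reparametrization phi & geodesic F 0 1 (fun t => g (1 - phi t)).
Proof.
move=> geo.
have hH (t : R) : 0 <= t <= 1 ->
    \forall s \near t, 0 < backward_speed s /\ {for s, continuous backward_speed}.
  move=> /geo[c ac ns]; have := near_join ns; apply: filterS => s /(backward_speed_ode ac).
  by move=> [k [h1 _ h2]]; split => //; exact: is_derive_continuous h2.
have [C [phi [C0 rphi phi01 dphi]]] := reparametrization_by_speed hH.
exists phi; first exact: rphi.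
move=> t t01.
have r01 : 0 <= 1 - phi t <= 1.
  by have := phi01 t t01 => /andP[h1 h2]; rewrite subr_ge0 h2/= lerBlDr lerDl.
have [c ac ns] := geo _ r01; exists c; first exact: ac.
have ndphi := near_join (dphi t t01).
have cphi : {for t, continuous (fun s : R => 1 - phi s)}.
  apply: cvgB; first exact: cvg_cst.
  exact: is_derive_continuous (nbhs_singleton (dphi t t01)).
have nns : \forall s \near t, \forall u \near (1 - phi s),
    cdom c (g u) /\ solves_geodesic_eq (F c) (fun u => cmap c (g u)) u.
  exact: (cphi _ (near_join ns)).
move: ndphi (near_join nns); apply: filterS2 => s nds nnss.
have ns_ := nbhs_singleton nnss.
have [cs [dX ddX X0 XE]] := nbhs_singleton ns_.
split; first exact: cs.
pose X u := cmap c (g u).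
set r := 1 - phi s in cs dX ddX X0 XE ns_.
have [k [H0 kE dH]] := backward_speed_ode ac ns_.
have dphis := nbhs_singleton nds.
pose w (u : R) := C / backward_speed (1 - phi u).
pose V (u : R) := - w u *: derive1 X (1 - phi u).
have w0 : 0 < w s by rewrite divr_gt0.
have d1phi (u : R) : is_derive u (1 : R) phi (w u) ->
    is_derive u (1 : R) (fun u : R => 1 - phi u) (- w u).
  move=> h; have := is_deriveB (is_derive_cst (1 : R) u (1 : R)) h.
  by rewrite sub0r.
have comp_curve (Y : R -> 'rV[R]_n) (u : R) : is_derive u (1 : R) phi (w u) ->
   derivable Y (1 - phi u) 1 ->
   is_derive u (1 : R) (fun u => Y (1 - phi u)) (- w u *: derive1 Y (1 - phi u)).
  move=> hp dY; have dY' : differentiable Y (1 - phi u) by apply/derivable1_diffP.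
  have := @is_derive_comp_curve R _ _ Y (fun u : R => 1 - phi u) u _ dY' (d1phi u hp).
  rewrite (deriveE _ dY') (diff1E dY') => h; exact: h.
have nV : \forall u \near s, is_derive u (1 : R) (fun u => cmap c (g (1 - phi u))) (V u).
  move: nds nnss; apply: filterS2 => u du nu.
  have [_ [dXu _ _ _]] := nbhs_singleton nu.
  exact: (comp_curve X u du dXu).
have V0 : V s != 0 by rewrite /V scaler_eq0 negb_or oppr_eq0 gt_eqF.
refine (solves_geodesicI nV _ V0).
have fhom x y (k' : R) (Ux : cimg c x) (k0 : 0 < k') :
    F c (x, k' *: y) = k' * F c (x, y) := finsler_homogeneous FF y ac Ux k0.
have sl : slit (cimg c) (X r, - derive1 X r).
  by split; [exists (g r)|rewrite /= oppr_eq0].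
have oU : open (cimg c) by exact: cimg_open.
have GE := spray_homog oU fhom (finsler_smooth FF ac) sl w0.
have VE : V s = w s *: - derive1 X r by rewrite /V scaleNr scalerN.
have dw : is_derive s (1 : R) (fun u => - w u) (- (2 * k * w s ^+ 2)).
  have d1 : is_derive s (1 : R) (fun u : R => backward_speed (1 - phi u))
      (2 * k * backward_speed r * - w s).
    exact: (@is_derive1_comp R backward_speed (fun u : R => 1 - phi u) s _ _
      dH (d1phi s dphis)).
  have H1 : backward_speed (1 - phi s) != 0 by rewrite gt_eqF.
  have d2 := is_deriveN (is_deriveZ C (@is_deriveV R
    (fun u : R => backward_speed (1 - phi u)) s _ _ H1 d1)).
  suff E : - (C * (- (backward_speed r) ^- 2 *
     (2 * k * backward_speed r * - w s))) = - (2 * k * w s ^+ 2).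
    by rewrite -E; exact: d2.
  rewrite /w -/r; move: (backward_speed r) H0 => b b0.
  by field; rewrite gt_eqF.
have dY := comp_curve (derive1 X) s dphis ddX.
have dV : is_derive s (1 : R) V
   (- w s *: (- w s *: derive1 (derive1 X) r) + - (2 * k * w s ^+ 2) *: derive1 X r).
  apply: is_derive_row => i.
  have := is_deriveM dw (is_derive_coord i dY).
  suff -> : (- w s *: (- w s *: derive1 (derive1 X) r) + - (2 * k * w s ^+ 2) *: derive1 X r) 0 i
     = - w s *: ((- w s *: derive1 (derive1 X) r) 0 i) +
        derive1 X r 0 i *: - (2 * k * w s ^+ 2).
    by congr is_derive; apply/funext => u; rewrite /V mxE.
  by move: (derive1 (derive1 X) r) (derive1 X r) => A B; rewrite !mxE [X in _ + X]mulrC.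
suff <- : - w s *: (- w s *: derive1 (derive1 X) r) + - (2 * k * w s ^+ 2) *: derive1 X r
   = - (2 *: spray (F c) (X r, V s)) by exact: dV.
rewrite VE GE.
have -> : derive1 (derive1 X) r = - (2 *: spray (F c) (X r, derive1 X r)).
  by apply/eqP; rewrite -addr_eq0; apply/eqP.
have -> : spray (F c) (X r, derive1 X r)
    = spray (F c) (X r, - derive1 X r) - k *: derive1 X r.
  by rewrite -kE opprB addrC subrK.
have vec (G Y : 'rV[R]_n) (a : R) :
    - a *: (- a *: - (2 *: (G - k *: Y))) + - (2 * k * a ^+ 2) *: Y
    = - (2 *: (a ^+ 2 *: G)).
  by apply/rowP => i; rewrite !mxE; ring.
exact: vec.
Qed.

End Reversal.

Theorem theorem4p2 (R : realType) (n : nat) (M : smooth_manifold R n)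
    (a : riemannian_metric M) (b : one_form M)
    (Mconnected : connected [set: M])
    (Ffinsler : finsler (quartic_randers a b))
    (Fflat : projectively_flat (quartic_randers a b)) :
  reversible_geodesics (quartic_randers a b).
Proof. by move=> g; exact: reverse_geodesic. Qed.
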